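(* Let $\mathcal N$ be a $5$-dimensional complex one-generated nilpotent Novikov algebra. Then $\mathcal N$ is isomorphic to one of the algebras ${\mathcal N}^5_{01}$, ${\mathcal N}^5_{02}(\lambda)$, ${\mathcal N}^5_{03}(\lambda,\mu)$, ${\mathcal N}^5_{04}(\lambda)$ with $\lambda\neq 0$, ${\mathcal N}^5_{05}$, ${\mathcal N}^5_{06}$, ${\mathcal N}^5_{07}(\lambda)$, ${\mathcal N}^5_{08}$, ${\mathcal N}^5_{09}(\lambda)$, ${\mathcal N}^5_{10}$, ${\mathcal N}^5_{11}(\lambda)$, ${\mathcal N}^5_{12}(\lambda)$, ${\mathcal N}^5_{13}(\lambda)$, where $\lambda,\mu\in\mathbb C$, whose multiplication tables are listed in the context.
   Context: A Novikov algebra is a vector space with a bilinear product satisfying, for all $x,y,z$, $(xy)z=(xz)y$ and $(xy)z-x(yz)=(yx)z-y(xz)$. An algebra is one-generated if it is generated as an algebra by a single element. It is nilpotent if there is some $k$ such that every product of $k$ elements, with any arrangement of brackets, is zero. Each algebra below is the complex algebra with basis $e_1,\dots,e_5$ and the displayed products of basis vectors; all products of basis vectors not displayed are zero. Parameters $\lambda,\mu$ range over $\mathbb C$ subject to the stated restrictions. - ${\mathcal N}^5_{01}$: $e_1e_1=e_2$, $e_1e_2=e_4$, $e_1e_3=e_5$, $e_2e_1=e_3$, $e_3e_1=-e_5$. - ${\mathcal N}^5_{02}(\lambda)$: $e_1e_1=e_2$, $e_1e_2=e_3$, $e_1e_3=(2-\lambda)e_5$, $e_2e_1=\lambda e_3+e_4$,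 $e_2e_2=\lambda e_5$, $e_3e_1=\lambda e_5$. - ${\mathcal N}^5_{03}(\lambda,\mu)$: $e_1e_1=e_2$, $e_1e_2=e_3$, $e_1e_3=\lambda e_5$, $e_1e_4=\mu e_5$, $e_2e_1=e_4$, $e_2e_2=e_5$, $e_3e_1=e_5$, $e_4e_1=(2-\mu)e_5$. - ${\mathcal N}^5_{04}(\lambda)$, $\lambda\neq0$: $e_1e_1=e_2$, $e_1e_2=e_3$, $e_1e_3=e_5$, $e_1e_4=\lambda e_5$, $e_2e_1=e_4$, $e_4e_1=-\lambda e_5$. - ${\mathcal N}^5_{05}$: $e_1e_1=e_2$, $e_1e_3=e_4$, $e_1e_4=2e_5$, $e_2e_1=e_3$, $e_2e_3=-e_5$, $e_3e_1=-e_4$, $e_4e_1=-e_5$. - ${\mathcal N}^5_{06}$: $e_1e_1=e_2$, $e_1e_2=e_5$, $e_1e_3=e_4$, $e_1e_4=2e_5$, $e_2e_1=e_3$, $e_2e_3=-e_5$, $e_3e_1=-e_4$, $e_4e_1=-e_5$. - ${\mathcal N}^5_{07}(\lambda)$: $e_1e_1=e_2$, $e_1e_2=e_3$, $e_1e_3=(2-\lambda)e_4$, $e_1e_4=(3-2\lambda)e_5$, $e_2e_1=\lambda e_3$, $e_2e_2=\lambda e_4$, $e_2e_3=\lambda(2-\lambda)e_5$, $e_3e_1=\lambda e_4$, $e_3e_2=\lambda e_5$, $e_4e_1=\lambda e_5$. - ${\mathcal N}^5_{08}$: $e_1e_1=e_2$, $e_1e_2=e_3$, $e_1e_3=e_4$,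 $e_1e_4=e_5$, $e_2e_1=e_5$. - ${\mathcal N}^5_{09}(\lambda)$: $e_1e_1=e_2$, $e_1e_2=e_3$, $e_1e_3=2e_4$, $e_1e_4=\lambda e_5$, $e_2e_3=2e_5$, $e_3e_2=-2e_5$, $e_4e_1=e_5$. - ${\mathcal N}^5_{10}$: $e_1e_1=e_2$, $e_1e_2=e_3$, $e_1e_3=e_4$, $e_1e_4=e_5$, $e_2e_1=e_3+e_5$, $e_2e_2=e_4$, $e_2e_3=e_5$, $e_3e_1=e_4$, $e_3e_2=e_5$, $e_4e_1=e_5$. - ${\mathcal N}^5_{11}(\lambda)$: $e_1e_1=e_2$, $e_1e_2=e_3$, $e_1e_3=2e_4+\lambda e_5$, $e_1e_4=2e_5$, $e_2e_1=e_4$, $e_2e_2=e_5$, $e_3e_1=e_5$. - ${\mathcal N}^5_{12}(\lambda)$: $e_1e_1=e_2$, $e_1e_2=e_3$, $e_1e_3=2e_4$, $e_1e_4=(2\lambda+1)e_5$, $e_2e_1=e_4$, $e_2e_2=\lambda e_5$, $e_2e_3=-2e_5$, $e_3e_1=\lambda e_5$, $e_3e_2=2e_5$, $e_4e_1=-e_5$. - ${\mathcal N}^5_{13}(\lambda)$: $e_1e_1=e_2$, $e_1e_2=e_3$, $e_1e_3=e_4-2e_5$, $e_1e_4=e_5$, $e_2e_1=e_3+e_4+\lambda e_5$, $e_2e_2=e_4$, $e_2e_3=e_5$, $e_3e_1=e_4$, $e_3e_2=e_5$, $e_4e_1=e_5$. *)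

(* Defs.v *)
From HB Require Import structures.
From mathcomp Require Import all_boot all_order all_algebra.
From mathcomp Require Import complex reals.

Set Implicit Arguments.
Unset Strict Implicit.
Unset Printing Implicit Defensive.

Import GRing.Theory.
Local Open Scope ring_scope.

Section Algebra.
Variables (K : fieldType) (V : vectType K) (mul : V -> V -> V).

Definition novikov : Prop :=
  (forall x y z : V, mul (mul x y) z = mul (mul x z) y) /\
  (forall x y z : V,
     mul (mul x y) z - mul x (mul y z) = mul (mul y x) z - mul y (mul x z)).

Definition subalgebra (U : {vspace V}) : Prop :=
  forall x y : V, x \in U -> y \in U -> mul x y \in U.

Definition one_generated : Prop :=
  exists a : V, forall U : {vspace V}, subalgebra U -> a \in U -> U = fullv.

(* [bracketed k x]: x is a product of k elements, for some arrangement of the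
   brackets. *)
Inductive bracketed : nat -> V -> Prop :=
| bracketed1 x : bracketed 1 x
| bracketedM m n x y :
    bracketed m x -> bracketed n y -> bracketed (m + n) (mul x y).

(* [bracketed 0] is empty, hence the condition 0 < k. *)
Definition nilpotent : Prop :=
  exists2 k : nat, (0 < k)%N & forall x : V, bracketed k x -> x = 0.

End Algebra.

Definition alg_isomorphic (K : fieldType) (V W : vectType K)
    (mulV : V -> V -> V) (mulW : W -> W -> W) : Prop :=
  exists f : {linear V -> W},
    bijective f /\ forall x y : V, f (mulV x y) = mulW (f x) (f y).

Section Tables.
Variable K : fieldType.
Implicit Types l m : K.

(* The basis vector e_k of K^5, for 1 <= k <= 5. *)
Definition e (k : nat) : 'rV[K]_5 := delta_mx 0 (inord k.-1).

(* The bilinear product on K^5 with e_i e_j = T i j; indices start at 1. *)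
Definition table_mul (T : nat -> nat -> 'rV[K]_5) (x y : 'rV[K]_5) : 'rV[K]_5 :=
  \sum_(i < 5) \sum_(j < 5) (x 0 i * y 0 j) *: T i.+1 j.+1.

Definition N01 : 'rV[K]_5 -> 'rV[K]_5 -> 'rV[K]_5 :=
  table_mul (fun i j => match i, j with
    | 1, 1 => e 2
    | 1, 2 => e 4
    | 1, 3 => e 5
    | 2, 1 => e 3
    | 3, 1 => - e 5
    | _, _ => 0
    end).

Definition N02 l : 'rV[K]_5 -> 'rV[K]_5 -> 'rV[K]_5 :=
  table_mul (fun i j => match i, j with
    | 1, 1 => e 2
    | 1, 2 => e 3
    | 1, 3 => (2 - l) *: e 5
    | 2, 1 => l *: e 3 + e 4
    | 2, 2 => l *: e 5
    | 3, 1 => l *: e 5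
    | _, _ => 0
    end).

Definition N03 l m : 'rV[K]_5 -> 'rV[K]_5 -> 'rV[K]_5 :=
  table_mul (fun i j => match i, j with
    | 1, 1 => e 2
    | 1, 2 => e 3
    | 1, 3 => l *: e 5
    | 1, 4 => m *: e 5
    | 2, 1 => e 4
    | 2, 2 => e 5
    | 3, 1 => e 5
    | 4, 1 => (2 - m) *: e 5
    | _, _ => 0
    end).

Definition N04 l : 'rV[K]_5 -> 'rV[K]_5 -> 'rV[K]_5 :=
  table_mul (fun i j => match i, j with
    | 1, 1 => e 2
    | 1, 2 => e 3
    | 1, 3 => e 5
    | 1, 4 => l *: e 5
    | 2, 1 => e 4
    | 4, 1 => - l *: e 5
    | _, _ => 0
    end).

Definition N05 : 'rV[K]_5 -> 'rV[K]_5 -> 'rV[K]_5 :=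
  table_mul (fun i j => match i, j with
    | 1, 1 => e 2
    | 1, 3 => e 4
    | 1, 4 => 2 *: e 5
    | 2, 1 => e 3
    | 2, 3 => - e 5
    | 3, 1 => - e 4
    | 4, 1 => - e 5
    | _, _ => 0
    end).

Definition N06 : 'rV[K]_5 -> 'rV[K]_5 -> 'rV[K]_5 :=
  table_mul (fun i j => match i, j with
    | 1, 1 => e 2
    | 1, 2 => e 5
    | 1, 3 => e 4
    | 1, 4 => 2 *: e 5
    | 2, 1 => e 3
    | 2, 3 => - e 5
    | 3, 1 => - e 4
    | 4, 1 => - e 5
    | _, _ => 0
    end).

Definition N07 l : 'rV[K]_5 -> 'rV[K]_5 -> 'rV[K]_5 :=
  table_mul (fun i j => match i, j with
    | 1, 1 => e 2
    | 1, 2 => e 3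
    | 1, 3 => (2 - l) *: e 4
    | 1, 4 => (3 - 2 * l) *: e 5
    | 2, 1 => l *: e 3
    | 2, 2 => l *: e 4
    | 2, 3 => (l * (2 - l)) *: e 5
    | 3, 1 => l *: e 4
    | 3, 2 => l *: e 5
    | 4, 1 => l *: e 5
    | _, _ => 0
    end).

Definition N08 : 'rV[K]_5 -> 'rV[K]_5 -> 'rV[K]_5 :=
  table_mul (fun i j => match i, j with
    | 1, 1 => e 2
    | 1, 2 => e 3
    | 1, 3 => e 4
    | 1, 4 => e 5
    | 2, 1 => e 5
    | _, _ => 0
    end).

Definition N09 l : 'rV[K]_5 -> 'rV[K]_5 -> 'rV[K]_5 :=
  table_mul (fun i j => match i, j with
    | 1, 1 => e 2
    | 1, 2 => e 3
    | 1, 3 => 2 *: e 4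
    | 1, 4 => l *: e 5
    | 2, 3 => 2 *: e 5
    | 3, 2 => - 2 *: e 5
    | 4, 1 => e 5
    | _, _ => 0
    end).

Definition N10 : 'rV[K]_5 -> 'rV[K]_5 -> 'rV[K]_5 :=
  table_mul (fun i j => match i, j with
    | 1, 1 => e 2
    | 1, 2 => e 3
    | 1, 3 => e 4
    | 1, 4 => e 5
    | 2, 1 => e 3 + e 5
    | 2, 2 => e 4
    | 2, 3 => e 5
    | 3, 1 => e 4
    | 3, 2 => e 5
    | 4, 1 => e 5
    | _, _ => 0
    end).

Definition N11 l : 'rV[K]_5 -> 'rV[K]_5 -> 'rV[K]_5 :=
  table_mul (fun i j => match i, j with
    | 1, 1 => e 2
    | 1, 2 => e 3
    | 1, 3 => 2 *: e 4 + l *: e 5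
    | 1, 4 => 2 *: e 5
    | 2, 1 => e 4
    | 2, 2 => e 5
    | 3, 1 => e 5
    | _, _ => 0
    end).

Definition N12 l : 'rV[K]_5 -> 'rV[K]_5 -> 'rV[K]_5 :=
  table_mul (fun i j => match i, j with
    | 1, 1 => e 2
    | 1, 2 => e 3
    | 1, 3 => 2 *: e 4
    | 1, 4 => (2 * l + 1) *: e 5
    | 2, 1 => e 4
    | 2, 2 => l *: e 5
    | 2, 3 => - 2 *: e 5
    | 3, 1 => l *: e 5
    | 3, 2 => 2 *: e 5
    | 4, 1 => - e 5
    | _, _ => 0
    end).

Definition N13 l : 'rV[K]_5 -> 'rV[K]_5 -> 'rV[K]_5 :=
  table_mul (fun i j => match i, j with
    | 1, 1 => e 2
    | 1, 2 => e 3
    | 1, 3 => e 4 - 2 *: e 5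
    | 1, 4 => e 5
    | 2, 1 => e 3 + e 4 + l *: e 5
    | 2, 2 => e 4
    | 2, 3 => e 5
    | 3, 1 => e 4
    | 3, 2 => e 5
    | 4, 1 => e 5
    | _, _ => 0
    end).

End Tables.

(* Main.v *)
Require Import Defs.
From HB Require Import structures.
From mathcomp Require Import all_boot all_order all_algebra.
From mathcomp Require Import complex reals.
From mathcomp Require Import ring zify.

(* Let x generate N, and let N^k be spanned by the products of k elements.
   Modulo N^(k+1) the power N^k is spanned by the products of x, on either side,
   with spanning vectors of N^(k-1), and the powers decrease strictly, so the
   factors N^k / N^(k+1) have dimensions 1, 1, 2, 1 or 1, 1, 1, 1, 1: a third
   factor of dimension 1 forces the fourth one to be a line, by left symmetry.
   In a basis adapted to the powers, the two Novikov identities determine the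
   multiplication table up to a few scalars.  In the case 1, 1, 2, 1 a rescaling
   of the last basis vector reaches one of N01, ..., N04.  In the case
   1, 1, 1, 1, 1 put y = x x.  If x y lies in N^4, replacing x by x + s y and
   rescaling leads to N05 or N06.  Otherwise y x = l (x y) modulo N^4; when l is
   neither 0 nor 1, replacing x by x + s y and then by x + t (x y) leads to N07,
   and the exceptional values l = 1 and l = 0 leave the algebras N10, N13 and
   N08, N09, N11, N12 besides N07. *)

Set Implicit Arguments.
Unset Strict Implicit.
Unset Printing Implicit Defensive.

Import GRing.Theory Num.Theory.
Local Open Scope ring_scope.

(** * The descending powers of a Novikov algebra and their generators *)

Section Powers.
Variables (K : fieldType) (V : vectType K) (mul : {bilinear V -> V -> V}).
Implicit Types (U W Z : {vspace V}) (x y z u v w : V).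

Local Notation "x ∘ y" := (mul x y) (at level 40, left associativity).

Definition prodv U W : {vspace V} :=
  <<[seq u ∘ w | u <- vbasis U, w <- vbasis W]>>.

Lemma mem_prodv U W u w : u \in U -> w \in W -> u ∘ w \in prodv U W.
Proof.
move=> /coord_vbasis -> /coord_vbasis ->.
rewrite linear_sumlz; apply: memv_suml => i _.
rewrite linear_sumr; apply: memv_suml => j _.
rewrite linearZlr /=; do 2!apply: memvZ.
by apply/memv_span/allpairs_f; apply: mem_nth; rewrite size_tuple.
Qed.

Lemma prodv_sub U W Z :
  (forall u w, u \in U -> w \in W -> u ∘ w \in Z) -> (prodv U W <= Z)%VS.
Proof.
move=> UWZ; apply/span_subvP => _ /allpairsP[[u w] /= [uU wW ->]].
by apply: UWZ; apply: vbasis_mem.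
Qed.

(* [npow k] is the power N^(k+1). *)
Fixpoint npow k : {vspace V} :=
  if k is k'.+1 then (prodv fullv (npow k') + prodv (npow k') fullv)%VS
  else fullv.

Lemma npow_sub k Z :
  (forall u w, w \in npow k -> u ∘ w \in Z /\ w ∘ u \in Z) ->
  (npow k.+1 <= Z)%VS.
Proof.
move=> kZ; rewrite subv_add; apply/andP.
by split; apply: prodv_sub => u w uk wk; [have [] := kZ u w wk
  | have [] := kZ w u uk].
Qed.

Lemma npow_mull k u w : w \in npow k -> u ∘ w \in npow k.+1.
Proof. by move=> wk; apply/(subvP (addvSl _ _))/mem_prodv; rewrite ?memvf. Qed.

Lemma npow_mulr k u w : w \in npow k -> w ∘ u \in npow k.+1.
Proof. by move=> wk; apply/(subvP (addvSr _ _))/mem_prodv; rewrite ?memvf. Qed.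

Lemma npow_decrS k : (npow k.+1 <= npow k)%VS.
Proof.
elim: k => [|k IH]; first exact: subvf.
apply: npow_sub => u w /(subvP IH) wk.
by split; [apply: npow_mull | apply: npow_mulr].
Qed.

Lemma npow_decr i j : (i <= j)%N -> (npow j <= npow i)%VS.
Proof.
move/subnKC <-; elim: (j - i)%N => [|k IH]; first by rewrite addn0 subvv.
by rewrite addnS; apply: subv_trans (npow_decrS _) IH.
Qed.

Lemma npow_stable k m : npow k.+1 = npow k -> npow (k + m) = npow k.
Proof.
move=> kE; elim: m => [|m IH]; first by rewrite addn0.
by rewrite addnS /= IH.
Qed.

Arguments npow : simpl never.

(** Induction on [k], with [Z] replaced by its preimages under left and right multiplication by a
    fixed vector. *)
Lemma npow_bracketed k Z :
  (forall x, bracketed mul k.+1 x -> x \in Z) -> (npow k <= Z)%VS.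
Proof.
elim: k Z => [|k IH] Z kZ.
  by apply/subvP => x _; apply/kZ/bracketed1.
apply: npow_sub => u w wk; split.
  have /subvP/(_ w wk) : (npow k <= linfun (mul u) @^-1: Z)%VS.
    apply: IH => v kv; rewrite -memv_preim lfunE.
    by apply/kZ/(bracketedM (m := 1)) => //; apply: bracketed1.
  by rewrite -memv_preim lfunE.
have /subvP/(_ w wk) : (npow k <= linfun (applyr mul u) @^-1: Z)%VS.
  apply: IH => v kv; rewrite -memv_preim lfunE /=.
  by apply/kZ; rewrite -addn1; apply: bracketedM => //; apply: bracketed1.
by rewrite -memv_preim lfunE.
Qed.

(** If the dimension did not drop, the powers would be stationary from [npow k] on, and hence
    contained in some N^m = 0. *)
Lemma dim_npow_decr k :
  nilpotent mul -> npow k != 0%VS -> (\dim (npow k.+1) < \dim (npow k))%N.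
Proof.
move=> [m m0 mN] k0; rewrite ltnNge; apply: contra k0 => le_k.
have kE : npow k.+1 = npow k by apply/eqP; rewrite eqEdim npow_decrS.
have : (npow (k + m.-1) <= 0)%VS.
  apply: subv_trans (npow_decr (leq_addl _ _)) _.
  by apply: npow_bracketed => x; rewrite prednK // memv0 => /mN ->.
by rewrite npow_stable // subv0.
Qed.

(** The generator enters the rest of the proof in this form, as a vector spanning N modulo N^2. *)
Definition generates x := (<[x]> + npow 1 = fullv)%VS.

(** Every product lies in [npow 1], so the sum is a subalgebra containing [x]. *)
Lemma one_generated_generates :
  one_generated mul -> exists x, generates x.
Proof.
move=> [x xgen]; exists x; apply: xgen; last first.
  by apply: (subvP (addvSl _ _)); apply: memv_line.
move=> u v _ _; apply: (subvP (addvSr _ _)).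
by apply: npow_mull; rewrite memvf.
Qed.

Hypothesis nov : novikov mul.

(** This is N^a N^b <= N^(a+b), the indices of [npow] being shifted by one. In the induction on [i],
    (w y) v = (w v) y by right commutativity, and left symmetry expresses (y w) v by products
    already treated. *)
Lemma npow_mul i j u v :
  u \in npow i -> v \in npow j -> u ∘ v \in npow (i + j).+1.
Proof.
have [rcomm lsym] := nov.
elim: i j u v => [|i IH] j u v; first by move=> _; apply: npow_mull.
move=> ui vj.
have /subvP/(_ u ui) :
    (npow i.+1 <= linfun (applyr mul v) @^-1: npow (i.+1 + j).+1)%VS.
  apply: npow_sub => y w wi; rewrite -!memv_preim !lfunE /= addSn.
  have wyv : w ∘ y ∘ v \in npow (i + j).+2.
    by rewrite rcomm; apply/npow_mulr/IH.
  split=> //.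
  have -> : y ∘ w ∘ v = w ∘ y ∘ v - w ∘ (y ∘ v) + y ∘ (w ∘ v).
    by rewrite -lsym subrK.
  apply: memvD; last by apply/npow_mull/IH.
  by apply: memvB => //; rewrite -addnS; apply/IH/npow_mull.
by rewrite -memv_preim lfunE.
Qed.

(** Every vector is a multiple of [x] plus some [u'] in N^2. By [npow_mul], multiplication by [u']
    raises the power by two, so modulo [npow k.+2] only multiplication by [x] counts. *)
Lemma npow_genS k x (s : seq V) :
  generates x -> npow k = (<<s>> + npow k.+1)%VS ->
  npow k.+1 = (<<map (mul x) s ++ map (mul^~ x) s>> + npow k.+2)%VS.
Proof.
move=> xgen kE; apply/eqP; rewrite eqEsubv; apply/andP; split; last first.
  rewrite subv_add npow_decrS andbT; apply/span_subvP => v.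
  have sk y : y \in s -> y \in npow k.
    by move=> ys; rewrite kE; apply/(subvP (addvSl _ _))/memv_span.
  by rewrite mem_cat => /orP[] /mapP[y /sk yk ->];
     [apply: npow_mull | apply: npow_mulr].
apply: npow_sub => u w wk.
have /memv_addP[_ /vlineP[l ->] [u' u'1 uE]] : u \in (<[x]> + npow 1)%VS.
  by rewrite xgen memvf.
have := wk; rewrite kE => /memv_addP[v vs [w' w'k wE]].
have u'w : u' ∘ w \in npow k.+2 := npow_mul u'1 wk.
have wu' : w ∘ u' \in npow k.+2 by have := npow_mul wk u'1; rewrite addn1.
rewrite span_cat -addvA uE linearDl linearDr linearZl_LR linearZr_LR /=.
(* Only the products with [x] are expanded; those with [u'] already lie in [npow k.+2]. *)
rewrite {1 3}wE linearDl linearDr !scalerDr -!addrA; split.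
  apply: memv_add; last first.
    apply/(subvP (addvSr _ _))/memvD => //.
    by apply: memvZ; apply: npow_mull.
  apply: memvZ; have := memv_img (linfun (mul x)) vs.
  by rewrite lfunE limg_span (eq_map (lfunE _)).
rewrite -[X in X \in _]add0r; apply: memv_add; first exact: mem0v.
apply: memv_add; last first.
  apply/memvD => //.
  by apply: memvZ; apply: npow_mulr.
apply: memvZ; have := memv_img (linfun (applyr mul x)) vs.
by rewrite lfunE limg_span (eq_map (lfunE _)).
Qed.

End Powers.

Arguments npow : simpl never.

(** * Combinations of five vectors, and multiplication tables adapted to the powers *)

Section Tables.
Variables (K : fieldType) (V : vectType K) (mul : {bilinear V -> V -> V}).

(** The five coordinates are explicit so that identities between products become coordinatewise
    [ring] or [field] goals. *)
Definition lc (e1 e2 e3 e4 e5 : V) (c1 c2 c3 c4 c5 : K) : V :=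
  c1 *: e1 + c2 *: e2 + c3 *: e3 + c4 *: e4 + c5 *: e5.

Section LinComb.
Variables e1 e2 e3 e4 e5 : V.
Local Notation L := (lc e1 e2 e3 e4 e5).

Lemma lcD a1 a2 a3 a4 a5 b1 b2 b3 b4 b5 :
  L a1 a2 a3 a4 a5 + L b1 b2 b3 b4 b5 =
  L (a1 + b1) (a2 + b2) (a3 + b3) (a4 + b4) (a5 + b5).
Proof.
by rewrite /lc !scalerDl addrACA; congr (_ + _);
   rewrite addrACA; congr (_ + _); rewrite addrACA; congr (_ + _);
   rewrite addrACA.
Qed.

Lemma lcZ k a1 a2 a3 a4 a5 :
  k *: L a1 a2 a3 a4 a5 = L (k * a1) (k * a2) (k * a3) (k * a4) (k * a5).
Proof. by rewrite /lc !scalerDr !scalerA. Qed.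

Lemma lcN a1 a2 a3 a4 a5 :
  - L a1 a2 a3 a4 a5 = L (- a1) (- a2) (- a3) (- a4) (- a5).
Proof. by rewrite -scaleN1r lcZ !mulN1r. Qed.

Lemma lc_0 : 0 = L 0 0 0 0 0.
Proof. by rewrite /lc !scale0r !addr0. Qed.

Lemma lc_1 : e1 = L 1 0 0 0 0.
Proof. by rewrite /lc !scale0r !addr0 scale1r. Qed.

Lemma lc_2 : e2 = L 0 1 0 0 0.
Proof. by rewrite /lc !scale0r !addr0 add0r scale1r. Qed.

Lemma lc_3 : e3 = L 0 0 1 0 0.
Proof. by rewrite /lc !scale0r !addr0 !add0r scale1r. Qed.

Lemma lc_4 : e4 = L 0 0 0 1 0.
Proof. by rewrite /lc !scale0r !addr0 !add0r scale1r. Qed.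

Definition lcE := (lcD, lcZ, lcN).

Hypotheses (spanE : (fullv <= <<[:: e1; e2; e3; e4; e5]>>)%VS)
           (dim5 : \dim {:V} = 5%N).

Let E := [tuple e1; e2; e3; e4; e5].

Lemma span5_basis : basis_of fullv E.
Proof. by rewrite basisEdim spanE dim5. Qed.

Let lc_sum (r : 'I_5 -> K) : \sum_i r i *: E`_i =
  L (r ord0) (r (lift ord0 ord0)) (r (lift ord0 (lift ord0 ord0)))
  (r (lift ord0 (lift ord0 (lift ord0 ord0))))
  (r (lift ord0 (lift ord0 (lift ord0 (lift ord0 ord0))))).
Proof. by rewrite !big_ord_recl big_ord0 addr0 /lc !addrA. Qed.

Lemma lc_inj a1 a2 a3 a4 a5 b1 b2 b3 b4 b5 :
  L a1 a2 a3 a4 a5 = L b1 b2 b3 b4 b5 ->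
  [/\ a1 = b1, a2 = b2, a3 = b3, a4 = b4 & a5 = b5].
Proof.
pose r (c1 c2 c3 c4 c5 : K) (i : 'I_5) := [:: c1; c2; c3; c4; c5]`_i.
move=> ab; have rab i : r a1 a2 a3 a4 a5 i = r b1 b2 b3 b4 b5 i.
  rewrite -!(coord_sum_free (X := E) _ _ (basis_free span5_basis)).
  by rewrite !lc_sum ab.
by split; [have := rab ord0 | have := rab (lift ord0 ord0)
  | have := rab (lift ord0 (lift ord0 ord0))
  | have := rab (lift ord0 (lift ord0 (lift ord0 ord0)))
  | have := rab (lift ord0 (lift ord0 (lift ord0 (lift ord0 ord0))))].
Qed.

Lemma lc_full v : exists c1 c2 c3 c4 c5, v = L c1 c2 c3 c4 c5.
Proof.
rewrite (coord_basis span5_basis (memvf v)) lc_sum.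
by do 5!eexists.
Qed.

Definition rowof v : 'rV[K]_5 := \row_i coord E i v.

Lemma rowof_linear : linear rowof.
Proof. by move=> x v1 v2; apply/rowP=> i; rewrite !mxE linearP. Qed.

HB.instance Definition _ := GRing.isSemilinear.Build K V _ _ rowof
  (GRing.semilinear_linear rowof_linear).

Lemma rowof_basis : rowof e1 = e K 1 /\ rowof e2 = e K 2 /\ rowof e3 = e K 3
  /\ rowof e4 = e K 4 /\ rowof e5 = e K 5.
Proof.
have H (i : 'I_5) : rowof E`_i = e K i.+1.
  apply/rowP => k; rewrite !mxE coord_free ?(basis_free span5_basis) //=.
  by rewrite inord_val eq_sym.
do !split; [exact: (H ord0) | exact: (H (lift ord0 ord0))
  | exact: (H (lift ord0 (lift ord0 ord0)))
  | exact: (H (lift ord0 (lift ord0 (lift ord0 ord0))))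
  | exact: (H (lift ord0 (lift ord0 (lift ord0 (lift ord0 ord0)))))].
Qed.

Lemma rowof_bij : bijective rowof.
Proof.
exists (fun r : 'rV_5 => \sum_i r 0 i *: E`_i) => [v|r].
  rewrite [v in RHS](coord_basis span5_basis) ?memvf//.
  by apply: eq_bigr => i; rewrite !mxE.
apply/rowP=> i.
by rewrite !mxE (coord_sum_free _ _ (basis_free span5_basis)).
Qed.

End LinComb.

(* The multiplication table
     e1 e1 = e2,                       e1 e2 = p3 e3 + p4 e4 + p5 e5,
     e2 e1 = q3 e3 + q4 e4 + q5 e5,    e1 e3 = a4 e4 + a5 e5,
     e3 e1 = b4 e4 + b5 e5,            e2 e2 = k4 e4 + k5 e5,
     e1 e4 = c e5,   e4 e1 = d e5,     e2 e3 = f e5,   e3 e2 = h e5,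
   all other products of basis vectors being 0. *)
Definition filtered (e1 e2 e3 e4 e5 : V)
    (p3 p4 p5 q3 q4 q5 a4 a5 b4 b5 k4 k5 c d f h : K) : Prop :=
  (fullv <= <<[:: e1; e2; e3; e4; e5]>>)%VS /\
  forall x1 x2 x3 x4 x5 y1 y2 y3 y4 y5,
    mul (lc e1 e2 e3 e4 e5 x1 x2 x3 x4 x5) (lc e1 e2 e3 e4 e5 y1 y2 y3 y4 y5) =
    lc e1 e2 e3 e4 e5 0 (x1 * y1) (p3 * (x1 * y2) + q3 * (x2 * y1))
      (p4 * (x1 * y2) + q4 * (x2 * y1) + a4 * (x1 * y3) + b4 * (x3 * y1) +
       k4 * (x2 * y2))
      (p5 * (x1 * y2) + q5 * (x2 * y1) + a5 * (x1 * y3) + b5 * (x3 * y1) +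
       k5 * (x2 * y2) + c * (x1 * y4) + d * (x4 * y1) + f * (x2 * y3) +
       h * (x3 * y2)).

Lemma filteredI e1 e2 e3 e4 e5 p3 p4 p5 q3 q4 q5 a4 a5 b4 b5 k4 k5 c d f h :
  (fullv <= <<[:: e1; e2; e3; e4; e5]>>)%VS ->
  let l := lc e1 e2 e3 e4 e5 in
  mul e1 e1 = e2 ->
  mul e1 e2 = l 0 0 p3 p4 p5 -> mul e2 e1 = l 0 0 q3 q4 q5 ->
  mul e1 e3 = l 0 0 0 a4 a5 -> mul e3 e1 = l 0 0 0 b4 b5 ->
  mul e2 e2 = l 0 0 0 k4 k5 ->
  mul e1 e4 = l 0 0 0 0 c -> mul e4 e1 = l 0 0 0 0 d ->
  mul e2 e3 = l 0 0 0 0 f -> mul e3 e2 = l 0 0 0 0 h ->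
  mul e3 e3 = 0 ->
  (forall v, v \in [:: e2; e3; e4] -> mul e4 v = 0 /\ mul v e4 = 0) ->
  (forall v, mul e5 v = 0 /\ mul v e5 = 0) ->
  filtered e1 e2 e3 e4 e5 p3 p4 p5 q3 q4 q5 a4 a5 b4 b5 k4 k5 c d f h.
Proof.
move=> spanE l E11 E12 E21 E13 E31 E22 E14 E41 E23 E32 E33 E4 E5.
have E5l v : mul e5 v = 0 by case: (E5 v).
have E5r v : mul v e5 = 0 by case: (E5 v).
have [|E42 E24] := E4 e2; first by rewrite !inE eqxx.
have [|E43 E34] := E4 e3; first by rewrite !inE eqxx orbT.
have [|E44 _] := E4 e4; first by rewrite !inE eqxx !orbT.
split=> // x1 x2 x3 x4 x5 y1 y2 y3 y4 y5.
rewrite {1 2}/lc !linearDl !linearDr !linearZlr /=.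
rewrite !(E33, E42, E24, E43, E34, E44, E5l, E5r) !scaler0 !addr0.
rewrite E11 E12 E21 E13 E31 E22 E14 E41 E23 E32.
rewrite [X in _ *: (_ *: X)](lc_2 e1 e2 e3 e4 e5) /l !lcE.
by congr (lc _ _ _ _ _ _ _ _ _ _); ring.
Qed.

End Tables.

(** * Coordinate isomorphisms onto algebras on K^5 *)

Section Iso.
Variable K : fieldType.

Definition lcrow : K -> K -> K -> K -> K -> 'rV[K]_5 :=
  lc (e K 1) (e K 2) (e K 3) (e K 4) (e K 5).

Lemma lcrowE c1 c2 c3 c4 c5 (i : 'I_5) :
  lcrow c1 c2 c3 c4 c5 0 i = [:: c1; c2; c3; c4; c5]`_i.
Proof.
rewrite /lcrow /lc !mxE /= -!val_eqE /= !inordK //.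
by case: i => -[|[|[|[|[|]]]]] //= _;
   rewrite !(mulr0, mulr1, addr0, add0r).
Qed.

Lemma table_mul_lcrow (T : nat -> nat -> 'rV[K]_5)
    x1 x2 x3 x4 x5 y1 y2 y3 y4 y5 :
  table_mul T (lcrow x1 x2 x3 x4 x5) (lcrow y1 y2 y3 y4 y5) =
  ((x1 * y1) *: T 1 1 + (x1 * y2) *: T 1 2 + (x1 * y3) *: T 1 3 +
     (x1 * y4) *: T 1 4 + (x1 * y5) *: T 1 5) +
  ((x2 * y1) *: T 2 1 + (x2 * y2) *: T 2 2 + (x2 * y3) *: T 2 3 +
     (x2 * y4) *: T 2 4 + (x2 * y5) *: T 2 5) +
  ((x3 * y1) *: T 3 1 + (x3 * y2) *: T 3 2 + (x3 * y3) *: T 3 3 +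
     (x3 * y4) *: T 3 4 + (x3 * y5) *: T 3 5) +
  ((x4 * y1) *: T 4 1 + (x4 * y2) *: T 4 2 + (x4 * y3) *: T 4 3 +
     (x4 * y4) *: T 4 4 + (x4 * y5) *: T 4 5) +
  ((x5 * y1) *: T 5 1 + (x5 * y2) *: T 5 2 + (x5 * y3) *: T 5 3 +
     (x5 * y4) *: T 5 4 + (x5 * y5) *: T 5 5).
Proof.
rewrite /table_mul !big_ord_recl !big_ord0 !lcrowE /=.
by rewrite !addr0 !addrA.
Qed.

(** The isomorphism is the coordinate map in the basis [e1], ..., [e5]. *)
Lemma filtered_iso (V : vectType K) (mul : {bilinear V -> V -> V})
    e1 e2 e3 e4 e5 p3 p4 p5 q3 q4 q5 a4 a5 b4 b5 k4 k5 c d f h T :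
  \dim {:V} = 5%N ->
  filtered mul e1 e2 e3 e4 e5 p3 p4 p5 q3 q4 q5 a4 a5 b4 b5 k4 k5 c d f h ->
  (forall x1 x2 x3 x4 x5 y1 y2 y3 y4 y5,
    table_mul T (lcrow x1 x2 x3 x4 x5) (lcrow y1 y2 y3 y4 y5) =
    lcrow 0 (x1 * y1) (p3 * (x1 * y2) + q3 * (x2 * y1))
      (p4 * (x1 * y2) + q4 * (x2 * y1) + a4 * (x1 * y3) + b4 * (x3 * y1) +
       k4 * (x2 * y2))
      (p5 * (x1 * y2) + q5 * (x2 * y1) + a5 * (x1 * y3) + b5 * (x3 * y1) +
       k5 * (x2 * y2) + c * (x1 * y4) + d * (x4 * y1) + f * (x2 * y3) +
       h * (x3 * y2))) ->
  alg_isomorphic mul (table_mul T).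
Proof.
move=> dim5 [spanE mulE] TE; exists (rowof e1 e2 e3 e4 e5).
split; first exact: rowof_bij.
have [f1 [f2 [f3 [f4 f5]]]] := rowof_basis spanE dim5.
have fE c1 c2 c3 c4 c5 :
    rowof e1 e2 e3 e4 e5 (lc e1 e2 e3 e4 e5 c1 c2 c3 c4 c5)
    = lcrow c1 c2 c3 c4 c5.
  rewrite [lc e1 e2 e3 e4 e5 _ _ _ _ _]/lc !linearD !linearZ /=.
  by rewrite f1 f2 f3 f4 f5.
move=> u v /=.
have [x1 [x2 [x3 [x4 [x5 ->]]]]] := lc_full spanE dim5 u.
have [y1 [y2 [y3 [y4 [y5 ->]]]]] := lc_full spanE dim5 v.
by rewrite mulE !fE TE.
Qed.

End Iso.

(** * The thirteen listed algebras in terms of the scalars of [filtered] *)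

Ltac table_iso F :=
  apply: (filtered_iso _ F) => // *; rewrite table_mul_lcrow /=;
  let i := fresh "i" in
  apply/rowP => i; rewrite lcrowE !mxE -!val_eqE /= !inordK //;
  case: i => -[|[|[|[|[|]]]]] i //=; clear i; ring.

Section FilteredTables.
Variables (K : fieldType) (V : vectType K) (mul : {bilinear V -> V -> V}).
Hypothesis dim5 : \dim {:V} = 5%N.
Variables e1 e2 e3 e4 e5 : V.
Local Notation filtered := (filtered mul e1 e2 e3 e4 e5).

Lemma filtered_N01 :
  filtered 0 1 0 1 0 0 0 1 0 (-1) 0 0 0 0 0 0 ->
  alg_isomorphic mul (@N01 K).
Proof. by move=> F; table_iso F. Qed.

Lemma filtered_N02 l :
  filtered 1 0 0 l 1 0 0 (2 - l) 0 l 0 l 0 0 0 0 ->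
  alg_isomorphic mul (N02 l).
Proof. by move=> F; table_iso F. Qed.

Lemma filtered_N03 l m :
  filtered 1 0 0 0 1 0 0 l 0 1 0 1 m (2 - m) 0 0 ->
  alg_isomorphic mul (N03 l m).
Proof. by move=> F; table_iso F. Qed.

Lemma filtered_N04 l :
  filtered 1 0 0 0 1 0 0 1 0 0 0 0 l (- l) 0 0 ->
  alg_isomorphic mul (N04 l).
Proof. by move=> F; table_iso F. Qed.

Lemma filtered_N05 :
  filtered 0 0 0 1 0 0 1 0 (-1) 0 0 0 2 (-1) (-1) 0 ->
  alg_isomorphic mul (@N05 K).
Proof. by move=> F; table_iso F. Qed.

Lemma filtered_N06 :
  filtered 0 0 1 1 0 0 1 0 (-1) 0 0 0 2 (-1) (-1) 0 ->
  alg_isomorphic mul (@N06 K).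
Proof. by move=> F; table_iso F. Qed.

Lemma filtered_N07 l :
  filtered 1 0 0 l 0 0 (2 - l) 0 l 0 l 0 (3 - 2 * l) l (l * (2 - l)) l ->
  alg_isomorphic mul (N07 l).
Proof. by move=> F; table_iso F. Qed.

Lemma filtered_N08 :
  filtered 1 0 0 0 0 1 1 0 0 0 0 0 1 0 0 0 ->
  alg_isomorphic mul (@N08 K).
Proof. by move=> F; table_iso F. Qed.

Lemma filtered_N09 l :
  filtered 1 0 0 0 0 0 2 0 0 0 0 0 l 1 2 (-2) ->
  alg_isomorphic mul (N09 l).
Proof. by move=> F; table_iso F. Qed.

Lemma filtered_N10 :
  filtered 1 0 0 1 0 1 1 0 1 0 1 0 1 1 1 1 ->
  alg_isomorphic mul (@N10 K).
Proof. by move=> F; table_iso F. Qed.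

Lemma filtered_N11 l :
  filtered 1 0 0 0 1 0 2 l 0 1 0 1 2 0 0 0 ->
  alg_isomorphic mul (N11 l).
Proof. by move=> F; table_iso F. Qed.

Lemma filtered_N12 l :
  filtered 1 0 0 0 1 0 2 0 0 l 0 l (2 * l + 1) (-1) (-2) 2 ->
  alg_isomorphic mul (N12 l).
Proof. by move=> F; table_iso F. Qed.

Lemma filtered_N13 l :
  filtered 1 0 0 1 1 l 1 (-2) 1 0 1 0 1 1 1 1 ->
  alg_isomorphic mul (N13 l).
Proof. by move=> F; table_iso F. Qed.

End FilteredTables.

(** * Triangular changes of basis *)

Section BaseChange.
Variables (K : fieldType) (V : vectType K) (mul : {bilinear V -> V -> V}).
Variables e1 e2 e3 e4 e5 : V.
Local Notation L := (lc e1 e2 e3 e4 e5).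

Lemma lc_lc a1 a2 a3 a4 a5 b1 b2 b3 b4 b5 c1 c2 c3 c4 c5 d1 d2 d3 d4 d5
    f1 f2 f3 f4 f5 x1 x2 x3 x4 x5 :
  lc (L a1 a2 a3 a4 a5) (L b1 b2 b3 b4 b5) (L c1 c2 c3 c4 c5)
     (L d1 d2 d3 d4 d5) (L f1 f2 f3 f4 f5) x1 x2 x3 x4 x5 =
  L (x1 * a1 + x2 * b1 + x3 * c1 + x4 * d1 + x5 * f1)
    (x1 * a2 + x2 * b2 + x3 * c2 + x4 * d2 + x5 * f2)
    (x1 * a3 + x2 * b3 + x3 * c3 + x4 * d3 + x5 * f3)
    (x1 * a4 + x2 * b4 + x3 * c4 + x4 * d4 + x5 * f4)
    (x1 * a5 + x2 * b5 + x3 * c5 + x4 * d5 + x5 * f5).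
Proof.
rewrite [lc (L _ _ _ _ _) _ _ _ _ _ _ _ _ _]/lc !(lcZ e1 e2 e3 e4 e5).
by rewrite !(lcD e1 e2 e3 e4 e5).
Qed.

(** Back substitution: [e5] is recovered first, then [e4] and so on up to [e1], each from one new
    vector and those already found. *)
Lemma triangular_span a1 a2 a3 a4 a5 b2 b3 b4 b5 c3 c4 c5 d4 d5 f5 :
  (fullv <= <<[:: e1; e2; e3; e4; e5]>>)%VS ->
  [&& a1 != 0, b2 != 0, c3 != 0, d4 != 0 & f5 != 0] ->
  (fullv <= <<[:: L a1 a2 a3 a4 a5; L 0 b2 b3 b4 b5; L 0 0 c3 c4 c5;
                  L 0 0 0 d4 d5; L 0 0 0 0 f5]>>)%VS.
Proof.
move=> spanE /and5P[a0 b0 c0 d0 f0].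
set Y := [:: L a1 _ _ _ _; _; _; _; _].
have Y1 : L a1 a2 a3 a4 a5 \in <<Y>>%VS by rewrite memv_span ?inE ?eqxx.
have Y2 : L 0 b2 b3 b4 b5 \in <<Y>>%VS by rewrite memv_span ?inE ?eqxx ?orbT.
have Y3 : L 0 0 c3 c4 c5 \in <<Y>>%VS by rewrite memv_span ?inE ?eqxx ?orbT.
have Y4 : L 0 0 0 d4 d5 \in <<Y>>%VS by rewrite memv_span ?inE ?eqxx ?orbT.
have Y5 : L 0 0 0 0 f5 \in <<Y>>%VS by rewrite memv_span ?inE ?eqxx ?orbT.
have step k u v : k != 0 -> k *: u + v \in <<Y>>%VS -> v \in <<Y>>%VS ->
    u \in <<Y>>%VS.
  move=> k0 kuv vY; have -> : u = k^-1 *: (k *: u + v - v).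
    by rewrite addrK scalerA mulVf // scale1r.
  by apply/memvZ/memvB.
have E5 : e5 \in <<Y>>%VS.
  apply: (step f5 _ 0) => //; last exact: mem0v.
  by move: Y5; rewrite /lc !scale0r !add0r addr0.
have E4 : e4 \in <<Y>>%VS.
  apply: (step d4 _ (d5 *: e5)) => //; last exact: memvZ.
  by move: Y4; rewrite /lc !scale0r !add0r.
have E3 : e3 \in <<Y>>%VS.
  apply: (step c3 _ (c4 *: e4 + c5 *: e5)) => //.
    by move: Y3; rewrite /lc !scale0r !add0r addrA.
  by do !apply: memvD; apply: memvZ.
have E2 : e2 \in <<Y>>%VS.
  apply: (step b2 _ (b3 *: e3 + b4 *: e4 + b5 *: e5)) => //.
    by move: Y2; rewrite /lc !scale0r !add0r !addrA.
  by do !apply: memvD; apply: memvZ.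
have E1 : e1 \in <<Y>>%VS.
  apply: (step a1 _ (a2 *: e2 + a3 *: e3 + a4 *: e4 + a5 *: e5)) => //.
    by move: Y1; rewrite /lc !addrA.
  by do !apply: memvD; apply: memvZ.
apply: subv_trans spanE _; apply/span_subvP => v.
by rewrite !inE => /or4P[|||/orP[]] /eqP ->.
Qed.

(** The new basis is t e1, t^2 e2, t^3 e3, p e4 + r e5, q e5. The powers of [t] preserve e1 e1 = e2,
    [p3] and [q3]; suitable [p] and [q] normalize entries in the last two coordinates, and [r] can
    clear an e5-coordinate next to a nonzero e4-coordinate. *)
Lemma filtered_rescale p3 p4 p5 q3 q4 q5 a4 a5 b4 b5 k4 k5 c d f h t p r q :
  [&& t != 0, p != 0 & q != 0] ->
  filtered mul e1 e2 e3 e4 e5 p3 p4 p5 q3 q4 q5 a4 a5 b4 b5 k4 k5 c d f h ->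
  exists f1 f2 f3 f4 f5, filtered mul f1 f2 f3 f4 f5
    p3 (t ^+ 3 * p4 / p) (t ^+ 3 * (p5 - p4 * r / p) / q)
    q3 (t ^+ 3 * q4 / p) (t ^+ 3 * (q5 - q4 * r / p) / q)
    (t ^+ 4 * a4 / p) (t ^+ 4 * (a5 - a4 * r / p) / q)
    (t ^+ 4 * b4 / p) (t ^+ 4 * (b5 - b4 * r / p) / q)
    (t ^+ 4 * k4 / p) (t ^+ 4 * (k5 - k4 * r / p) / q)
    (t * p * c / q) (t * p * d / q) (t ^+ 5 * f / q) (t ^+ 5 * h / q).
Proof.
move=> /and3P[t0 p0 q0] [spanE mulE].
exists (L t 0 0 0 0), (L 0 (t ^+ 2) 0 0 0), (L 0 0 (t ^+ 3) 0 0), (L 0 0 0 p r),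
  (L 0 0 0 0 q); split.
  by apply: triangular_span => //; rewrite t0 p0 q0 !expf_neq0.
move=> x1 x2 x3 x4 x5 y1 y2 y3 y4 y5; rewrite !lc_lc mulE.
congr (L _ _ _ _ _).
- by ring.
- by ring.
- by ring.
- by field; rewrite p0 ?q0.
- by field; rewrite p0 ?q0.
Qed.

End BaseChange.

(** * Relations forced by the Novikov identities, and shears of the generator *)

Section Normalization.
Variables (K : fieldType) (V : vectType K) (mul : {bilinear V -> V -> V}).
Hypotheses (dim5 : \dim {:V} = 5%N) (nov : novikov mul).
Local Notation filtered := (filtered mul).

(** Turns a coordinate identity into a wanted relation, up to the factor [k], leaving a [ring]
    goal. *)
Lemma eq_scaled_diff (k u v x y : K) : u = v -> x - y = k * (u - v) -> x = y.
Proof. by move=> ->; rewrite subrr mulr0 => /subr0_eq. Qed.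

(** Right commutativity at (e1,e1,e2), (e1,e1,e3), (e2,e1,e2) gives the first four relations, left
    symmetry at (e1,e2,e1) and (e1,e2,e2) the other three. *)
Lemma novikov_relations e1 e2 e3 e4 e5 l g m a4 a5 b4 b5 k4 k5 c d f h :
  filtered e1 e2 e3 e4 e5 1 0 0 l g m a4 a5 b4 b5 k4 k5 c d f h ->
  [/\ k4 = b4, k5 = b5, f = a4 * d & l * h = b4 * d] /\
  [/\ (1 - l) * h + f = b4 * c, (2 - l) * b4 = l * a4 &
     (2 - l) * b5 = l * a5 + g * (c + d)].
Proof.
move=> [spanE mulE]; have [rc ls] := nov.
pose L := lc e1 e2 e3 e4 e5.
have simpl_lc := (mul0r, mulr0, mul1r, mulr1, add0r, addr0, oppr0).
have := rc (L 1 0 0 0 0) (L 1 0 0 0 0) (L 0 1 0 0 0).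
rewrite !mulE => /(lc_inj spanE dim5)[_ _ _]; rewrite !simpl_lc => bk4 bk5.
have := rc (L 1 0 0 0 0) (L 1 0 0 0 0) (L 0 0 1 0 0).
rewrite !mulE => /(lc_inj spanE dim5)[_ _ _ _]; rewrite !simpl_lc => fE.
have := rc (L 0 1 0 0 0) (L 1 0 0 0 0) (L 0 1 0 0 0).
rewrite !mulE => /(lc_inj spanE dim5)[_ _ _ _]; rewrite !simpl_lc => hE.
have := ls (L 1 0 0 0 0) (L 0 1 0 0 0) (L 1 0 0 0 0).
rewrite !mulE !lcN !lcD => /(lc_inj spanE dim5)[_ _ _].
rewrite !simpl_lc => ab4 ab5.
have := ls (L 1 0 0 0 0) (L 0 1 0 0 0) (L 0 1 0 0 0).
rewrite !mulE !lcN !lcD => /(lc_inj spanE dim5)[_ _ _ _].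
rewrite !simpl_lc => hfE.
do !split=> //.
- by rewrite fE mulrC.
- by rewrite [LHS]mulrC hE bk4 mulrC.
- by rewrite -bk4; apply: (eq_scaled_diff (k := 1) hfE); ring.
- by apply: (eq_scaled_diff (k := 1) ab4); rewrite bk4; ring.
- by apply: (eq_scaled_diff (k := 1) ab5); rewrite bk5; ring.
Qed.

(** Here e3 = e2 e1 and e1 e2 has no e3-component. Left symmetry at (e1,e3,e1) gives the last
    relation, which ties [c] to [d] when [a4] is nonzero. *)
Lemma novikov_relations_right e1 e2 e3 e4 e5 g m a4 a5 b4 b5 k4 k5 c d f h :
  filtered e1 e2 e3 e4 e5 0 g m 1 0 0 a4 a5 b4 b5 k4 k5 c d f h ->
  [/\ k4 = 0, k5 = g * d, f = a4 * d & h = 0] /\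
  [/\ b4 = - a4, b5 = 2 * g * d - a5 & a4 * (c + 2 * d) = 0].
Proof.
move=> [spanE mulE]; have [rc ls] := nov.
pose L := lc e1 e2 e3 e4 e5.
have simpl_lc := (mul0r, mulr0, mul1r, mulr1, add0r, addr0, oppr0).
have := rc (L 1 0 0 0 0) (L 1 0 0 0 0) (L 0 1 0 0 0).
rewrite !mulE => /(lc_inj spanE dim5)[_ _ _]; rewrite !simpl_lc => k4E k5E.
have := rc (L 1 0 0 0 0) (L 1 0 0 0 0) (L 0 0 1 0 0).
rewrite !mulE => /(lc_inj spanE dim5)[_ _ _ _]; rewrite !simpl_lc => fE.
have := rc (L 0 1 0 0 0) (L 1 0 0 0 0) (L 0 1 0 0 0).
rewrite !mulE => /(lc_inj spanE dim5)[_ _ _ _].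
rewrite !simpl_lc k4E mulr0 => hE.
have := ls (L 1 0 0 0 0) (L 0 1 0 0 0) (L 1 0 0 0 0).
rewrite !mulE !lcN !lcD => /(lc_inj spanE dim5)[_ _ _].
rewrite !simpl_lc => ab4 ab5.
have := ls (L 1 0 0 0 0) (L 0 0 1 0 0) (L 1 0 0 0 0).
rewrite !mulE !lcN !lcD => /(lc_inj spanE dim5)[_ _ _ _].
rewrite !simpl_lc => cdE.
have b4E : b4 = - a4.
  by apply: (eq_scaled_diff (k := -1) ab4); rewrite k4E; ring.
do !split=> //.
- by rewrite k5E mulrC.
- by rewrite fE mulrC.
- by apply: (eq_scaled_diff (k := -1) ab5); rewrite k5E; ring.
- by apply: (eq_scaled_diff (k := 1) cdE); rewrite hE b4E; ring.
Qed.

Lemma novikov_relations_short e1 e2 e3 e4 e5 a5 b5 k5 c d :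
  filtered e1 e2 e3 e4 e5 1 0 0 0 1 0 0 a5 0 b5 0 k5 c d 0 0 ->
  k5 = b5 /\ c = 2 * b5 - d.
Proof.
move=> [spanE mulE]; have [rc ls] := nov.
pose L := lc e1 e2 e3 e4 e5.
have simpl_lc := (mul0r, mulr0, mul1r, mulr1, add0r, addr0, oppr0).
have := rc (L 1 0 0 0 0) (L 1 0 0 0 0) (L 0 1 0 0 0).
rewrite !mulE => /(lc_inj spanE dim5)[_ _ _ _]; rewrite !simpl_lc => k5E.
have := ls (L 1 0 0 0 0) (L 0 1 0 0 0) (L 1 0 0 0 0).
rewrite !mulE !lcN !lcD => /(lc_inj spanE dim5)[_ _ _ _].
rewrite !simpl_lc => cE; split=> //.
by apply: (eq_scaled_diff (k := -1) cE); rewrite k5E; ring.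
Qed.

(** With [a4], [b4], [k4], [f] and [h] zero, [e3] and [e4] play the same role: each multiplies only
    with [e1], into [e5]. The swap leads to [N01], where e3 is e2 e1. *)
Lemma filtered_swap e1 e2 e3 e4 e5 p3 p4 p5 q3 q4 q5 a5 b5 k5 c d :
  filtered e1 e2 e3 e4 e5 p3 p4 p5 q3 q4 q5 0 a5 0 b5 0 k5 c d 0 0 ->
  filtered e1 e2 e4 e3 e5 p4 p3 p5 q4 q3 q5 0 c 0 d 0 k5 a5 b5 0 0.
Proof.
have lcC f1 f2 f3 f4 f5 x1 x2 x3 x4 x5 :
    lc f1 f2 f4 f3 f5 x1 x2 x3 x4 x5 = lc f1 f2 f3 f4 f5 x1 x2 x4 x3 x5 :> V.
  by rewrite /lc; congr (_ + _); rewrite addrAC.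
move=> [spanE mulE]; split=> [|*].
  apply: subv_trans spanE _; apply: sub_span => v.
  by rewrite !inE => /or4P[|||/orP[]] /eqP ->; rewrite eqxx ?orbT.
by rewrite !(lcC e1 e2 e3 e4 e5) mulE; congr (lc _ _ _ _ _ _ _ _ _ _); ring.
Qed.

(** Replacing e1 by e1 + s e2 adds l^2 (l - 1) s to [g], which can therefore be cleared. *)
Lemma shear_square_generic e1 e2 e3 e4 e5 (l g m : K) :
  l != 0 -> l - 1 != 0 ->
  filtered e1 e2 e3 e4 e5 1 0 0 l g m (2 - l) (- ((3 - l) * g / l)) l 0 l 0
    (3 - 2 * l) l (l * (2 - l)) l ->
  exists m' f1 f2 f3 f4 f5, filtered f1 f2 f3 f4 f5
    1 0 0 l 0 m' (2 - l) 0 l 0 l 0 (3 - 2 * l) l (l * (2 - l)) l.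
Proof.
move=> l0 l1 [spanE mulE].
(* This [s] makes the e4-component of (y y) y - l (y (y y)) vanish for the new
   generator y = e1 + s e2. *)
pose s := - g / (l ^+ 2 * (l - 1)).
(* The square of the new e1 is e2 + S e3 + U e4 + m s e5, the new e1 times this is e3 + A e4 + W e5,
   and the latter times the new e1 is l (e4 + (A + s) e5). The witness for [m'] is the e5-coordinate
   of e2 e1 - l e3 in the new basis. *)
pose S := (1 + l) * s; pose U := g * s + l * s ^+ 2.
pose A := (2 - l) * S + l * s.
pose W := - ((3 - l) * g / l) * S + (3 - 2 * l) * U + l * (2 - l) * s * S.
exists (m + l * U + l * S * s - l * W), (lc e1 e2 e3 e4 e5 1 s 0 0 0),
  (lc e1 e2 e3 e4 e5 0 1 S U (m * s)), (lc e1 e2 e3 e4 e5 0 0 1 A W),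
  (lc e1 e2 e3 e4 e5 0 0 0 1 (A + s)), (lc e1 e2 e3 e4 e5 0 0 0 0 1); split.
  by apply: triangular_span => //; rewrite oner_eq0.
move=> *; rewrite !lc_lc mulE /W /A /U /S /s.
by congr (lc _ _ _ _ _ _ _ _ _ _); field; rewrite ?l0 ?l1.
Qed.

Lemma shear_cube_generic e1 e2 e3 e4 e5 (l m : K) :
  2 != 0 :> K -> l != 0 -> l - 1 != 0 ->
  filtered e1 e2 e3 e4 e5
    1 0 0 l 0 m (2 - l) 0 l 0 l 0 (3 - 2 * l) l (l * (2 - l)) l ->
  exists f1 f2 f3 f4 f5, filtered f1 f2 f3 f4 f5
    1 0 0 l 0 0 (2 - l) 0 l 0 l 0 (3 - 2 * l) l (l * (2 - l)) l.
Proof.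
move=> two0 l0 l1 [spanE mulE].
(* Passing from e1 to e1 + t e3 adds 2 l (l - 1) t to [m]. *)
pose t := - m / (2 * l * (l - 1)).
exists (lc e1 e2 e3 e4 e5 1 0 t 0 0),
  (lc e1 e2 e3 e4 e5 0 1 0 (2 * t) 0),
  (lc e1 e2 e3 e4 e5 0 0 1 0 ((2 * (3 - 2 * l) + l) * t)),
  (lc e1 e2 e3 e4 e5 0 0 0 1 0), (lc e1 e2 e3 e4 e5 0 0 0 0 1); split.
  by apply: triangular_span => //; rewrite oner_eq0.
move=> *; rewrite !lc_lc mulE /t.
by congr (lc _ _ _ _ _ _ _ _ _ _); field; rewrite ?l0 ?l1 ?two0.
Qed.

Lemma shear_cube_zero e1 e2 e3 e4 e5 (g m b c : K) :
  2 != 0 :> K ->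
  filtered e1 e2 e3 e4 e5 1 0 0 0 g m 2 0 0 b 0 b c 1 2 (-2) ->
  exists f1 f2 f3 f4 f5, filtered f1 f2 f3 f4 f5
    1 0 0 0 g 0 2 0 0 b 0 b c 1 2 (-2).
Proof.
move=> two0 [spanE mulE].
(* Passing from e1 to e1 + t e3 adds 4 t to [m]. *)
pose t := - m / 2 / 2.
exists (lc e1 e2 e3 e4 e5 1 0 t 0 0),
  (lc e1 e2 e3 e4 e5 0 1 0 (2 * t) (b * t)),
  (lc e1 e2 e3 e4 e5 0 0 1 0 ((2 * c - 2) * t)),
  (lc e1 e2 e3 e4 e5 0 0 0 1 0), (lc e1 e2 e3 e4 e5 0 0 0 0 1); split.
  by apply: triangular_span => //; rewrite oner_eq0.
move=> *; rewrite !lc_lc mulE /t.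
by congr (lc _ _ _ _ _ _ _ _ _ _); field; rewrite ?two0.
Qed.

(** Replacing e1 by e1 - g e2 gives the new e2 the term - g e3, and e1 e3 = e4 then cancels the term
    g e4 of e1 e2. The new e3 and e4 are the new e2 e1 and e1 e3. *)
Lemma shear_square_right e1 e2 e3 e4 e5 (g m : K) :
  filtered e1 e2 e3 e4 e5
    0 g m 1 0 0 1 0 (-1) (- 2 * g) 0 (- g) 2 (-1) (-1) 0 ->
  exists m' f1 f2 f3 f4 f5, filtered f1 f2 f3 f4 f5
    0 0 m' 1 0 0 1 0 (-1) 0 0 0 2 (-1) (-1) 0.
Proof.
move=> [spanE mulE].
exists (m - 2 * g ^+ 2), (lc e1 e2 e3 e4 e5 1 (- g) 0 0 0),
  (lc e1 e2 e3 e4 e5 0 1 (- g) (- g ^+ 2) (- m * g - g ^+ 3)),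
  (lc e1 e2 e3 e4 e5 0 0 1 g (4 * g ^+ 2)),
  (lc e1 e2 e3 e4 e5 0 0 0 1 (3 * g)), (lc e1 e2 e3 e4 e5 0 0 0 0 1); split.
  by apply: triangular_span => //; rewrite oner_eq0.
move=> *; rewrite !lc_lc mulE.
by congr (lc _ _ _ _ _ _ _ _ _ _); ring.
Qed.

End Normalization.

(** * Reduction of the tables to the listed algebras over an algebraically closed field of
    characteristic zero *)

Definition listed (K : fieldType) (V : vectType K) (mul : V -> V -> V) : Prop :=
  alg_isomorphic mul (@N01 _)
  \/ (exists l : K, alg_isomorphic mul (N02 l))
  \/ (exists l m : K, alg_isomorphic mul (N03 l m))
  \/ (exists l : K, l != 0 /\ alg_isomorphic mul (N04 l))
  \/ alg_isomorphic mul (@N05 _)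
  \/ alg_isomorphic mul (@N06 _)
  \/ (exists l : K, alg_isomorphic mul (N07 l))
  \/ alg_isomorphic mul (@N08 _)
  \/ (exists l : K, alg_isomorphic mul (N09 l))
  \/ alg_isomorphic mul (@N10 _)
  \/ (exists l : K, alg_isomorphic mul (N11 l))
  \/ (exists l : K, alg_isomorphic mul (N12 l))
  \/ (exists l : K, alg_isomorphic mul (N13 l)).

(** Lets [same_table] match two tables through one identity per scalar. *)
Lemma eq_transport (P Q : Prop) : P = Q -> P -> Q.
Proof. by move=> ->. Qed.

Ltac same_table F := apply: (eq_transport _ F);
  congr (filtered _ _ _ _ _ _ _ _ _ _ _ _ _ _ _ _ _ _ _ _ _ _).

Section Classification.
Variables (K : numClosedFieldType) (V : vectType K).
Variable (mul : {bilinear V -> V -> V}).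
Hypotheses (dim5 : \dim {:V} = 5%N) (nov : novikov mul).
Local Notation filtered := (filtered mul).

Let two0 : 2 != 0 :> K. Proof. by rewrite pnatr_eq0. Qed.
Let three0 : 3 != 0 :> K. Proof. by rewrite pnatr_eq0. Qed.

(** Rescaling [e5] suffices: b5 != 0 gives [N03]; for b5 = 0, a5 = 0 gives [N01] after a swap, and
    a5 != 0 gives [N02] or [N04] according to [d]. *)
Lemma listed_short e1 e2 e3 e4 e5 (a5 b5 k5 c d : K) :
  filtered e1 e2 e3 e4 e5 1 0 0 0 1 0 0 a5 0 b5 0 k5 c d 0 0 ->
  [|| a5 != 0, b5 != 0 | d != 0] -> listed mul.
Proof.
move=> F; have [k5E cE] := novikov_relations_short dim5 nov F.
move: F; rewrite {}k5E {}cE => F abd.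
have [b0|b0] := eqVneq b5 0; last first.
  have [|f1 [f2 [f3 [f4 [f5 {}F]]]]] :=
    filtered_rescale (t := 1) (p := 1) (q := b5) 0 _ F.
    by rewrite oner_eq0 b0.
  right; right; left; exists (a5 / b5), (2 - d / b5).
  apply: (filtered_N03 dim5
    (e1 := f1) (e2 := f2) (e3 := f3) (e4 := f4) (e5 := f5)).
  by same_table F; field; rewrite ?b0.
move: abd F; rewrite {}b0 eqxx /=.
have [->|a0] := eqVneq a5 0; rewrite ?eqxx /=.
  move=> d0 F.
  have [|f1 [f2 [f3 [f4 [f5 {}F]]]]] :=
    filtered_rescale (t := 1) (p := 1) (q := - d) 0 _ (filtered_swap F).
    by rewrite oner_eq0 oppr_eq0 d0.
  left.
  apply: (filtered_N01 dim5
    (e1 := f1) (e2 := f2) (e3 := f3) (e4 := f4) (e5 := f5)).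
  by same_table F; field; rewrite ?d0.
move=> _ F; have [d0|d0] := eqVneq d 0.
  (* The table of [N02 0] has e1 e3 = 2 e5, hence the factor 1/2. *)
  have [|f1 [f2 [f3 [f4 [f5 {}F]]]]] :=
    filtered_rescale (t := 1) (p := 1) (q := a5 / 2) 0 _ F.
    by rewrite oner_eq0 mulf_neq0 ?invr_eq0.
  right; left; exists 0.
  apply: (filtered_N02 dim5
    (e1 := f1) (e2 := f2) (e3 := f3) (e4 := f4) (e5 := f5)).
  by same_table F; rewrite ?d0; field; rewrite ?a0 ?two0.
have [|f1 [f2 [f3 [f4 [f5 {}F]]]]] :=
  filtered_rescale (t := 1) (p := 1) (q := a5) 0 _ F.
  by rewrite oner_eq0 a0.
right; right; right; left; exists (- d / a5); split.
  by rewrite mulf_neq0 ?oppr_eq0 ?invr_eq0.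
apply: (filtered_N04 dim5
  (e1 := f1) (e2 := f2) (e3 := f3) (e4 := f4) (e5 := f5)).
by same_table F; field; rewrite ?a0.
Qed.

(** The relations give c = - 2 d, so rescaling reaches a4 = 1, c = 2, d = -1. The shear then clears
    [g], and the remaining scalar [m'] decides between [N05] and [N06]. *)
Lemma listed_right e1 e2 e3 e4 e5 (g m a4 a5 b4 b5 k4 k5 c d f h : K) :
  filtered e1 e2 e3 e4 e5 0 g m 1 0 0 a4 a5 b4 b5 k4 k5 c d f h ->
  (a4 != 0) || (b4 != 0) -> (c != 0) || (d != 0) -> listed mul.
Proof.
move=> F.
have [[k4E k5E fE hE] [b4E b5E cE]] := novikov_relations_right dim5 nov F.
move: F; rewrite {}k4E {}k5E {}fE {}hE {}b4E {}b5E oppr_eq0 orbb => F a0.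
have {}cE : c = - (2 * d).
  by apply/eqP; rewrite -addr_eq0; move/eqP: cE; rewrite mulf_eq0 (negPf a0).
move: F; rewrite {}cE oppr_eq0 mulf_eq0 (negPf two0) orbb /= => F d0.
have [|f1 [f2 [f3 [f4 [f5 {}F]]]]] :=
  filtered_rescale (t := 1) (p := a4) (q := - (a4 * d)) a5 _ F.
  by rewrite oner_eq0 a0 oppr_eq0 mulf_neq0.
have [|m' [{}f1 [{}f2 [{}f3 [{}f4 [{}f5 {}F]]]]]] :=
  @shear_square_right _ _ mul f1 f2 f3 f4 f5 (g / a4)
    (- (m - g * a5 / a4) / (a4 * d)).
  by same_table F; field; rewrite ?a0 ?d0.
have [m0|m0] := eqVneq m' 0.
  do 4!right; left.
  by apply: (filtered_N05 dim5); move: F; rewrite m0; apply.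
(* The rescaling divides [m'] by t^2, so a square root of [m'] makes it 1. *)
pose s := sqrtC m'; have mE : m' = s ^+ 2 by rewrite sqrtCK.
have s0 : s != 0 by rewrite sqrtC_eq0.
have [|{}f1 [{}f2 [{}f3 [{}f4 [{}f5 {}F]]]]] :=
  filtered_rescale (t := s) (p := s ^+ 4) (q := s ^+ 5) 0 _ F.
  by rewrite s0 !expf_neq0.
do 5!right; left.
apply: (filtered_N06 dim5
  (e1 := f1) (e2 := f2) (e3 := f3) (e4 := f4) (e5 := f5)).
by same_table F; rewrite ?mE; field; rewrite ?s0.
Qed.

(** For l = 1 the shears do not apply: g != 0 is scaled to 1 and gives [N13], while g = 0 leaves
    [N07 1] or [N10] according to [m]. *)
Lemma listed_generic e1 e2 e3 e4 e5 (l g m : K) :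
  l != 0 ->
  filtered e1 e2 e3 e4 e5 1 0 0 l g m (2 - l) (- ((3 - l) * g / l)) l 0 l 0
    (3 - 2 * l) l (l * (2 - l)) l ->
  listed mul.
Proof.
move=> l0 F; have [l1|l1] := eqVneq l 1; last first.
  have {}l1 : l - 1 != 0 by rewrite subr_eq0.
  have [m' [f1 [f2 [f3 [f4 [f5 {}F]]]]]] := shear_square_generic l0 l1 F.
  have [{}f1 [{}f2 [{}f3 [{}f4 [{}f5 {}F]]]]] :=
    shear_cube_generic two0 l0 l1 F.
  do 6!right; left; exists l.
  exact: (filtered_N07 dim5 F).
have [g0|g0] := eqVneq g 0; last first.
  move: F; rewrite {}l1 => F; have [|f1 [f2 [f3 [f4 [f5 {}F]]]]] :=
    filtered_rescale (t := g) (p := g ^+ 4) (q := g ^+ 5) 0 _ F.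
    by rewrite g0 !expf_neq0.
  do 12!right; exists (m / g ^+ 2).
  apply: (filtered_N13 dim5
    (e1 := f1) (e2 := f2) (e3 := f3) (e4 := f4) (e5 := f5)).
  by same_table F; field; rewrite ?g0.
move: F; rewrite {}g0 => F.
have [m0|m0] := eqVneq m 0.
  do 6!right; left; exists l.
  by apply: (filtered_N07 dim5); move: F; rewrite m0 mulr0 mul0r oppr0; apply.
move: F; rewrite {}l1 => F; pose s := sqrtC m.
have mE : m = s ^+ 2 by rewrite sqrtCK.
have s0 : s != 0 by rewrite sqrtC_eq0.
have [|f1 [f2 [f3 [f4 [f5 {}F]]]]] := filtered_rescale (t := s)
    (p := s ^+ 4) (q := s ^+ 5) 0 _ F.
  by rewrite s0 !expf_neq0.
do 9!right; left.
apply: (filtered_N10 dim5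
  (e1 := f1) (e2 := f2) (e3 := f3) (e4 := f4) (e5 := f5)).
by same_table F; rewrite ?mE; field; rewrite ?s0.
Qed.

(** The case l = 0. For d != 0 a shear by e3 clears [m], and [g] separates [N09] from [N12]. For d =
    0, g != 0 gives [N11], and g = 0 gives [N07 0] or [N08] according to [m]. *)
Lemma listed_zero e1 e2 e3 e4 e5 (g m a4 a5 c d : K) :
  a4 != 0 -> (c != 0) || (d != 0) ->
  filtered e1 e2 e3 e4 e5 1 0 0 0 g m a4 a5 0 (g * (c + d) / 2)
    0 (g * (c + d) / 2) c d (a4 * d) (- (a4 * d)) ->
  listed mul.
Proof.
move=> a0 cd F; have [d0|d0] := eqVneq d 0; last first.
  (* These [p], [q] and [r] make the new [a4] equal to 2, the new [d] equal to 1 and the new [a5]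
     zero. *)
  have [|f1 [f2 [f3 [f4 [f5 {}F]]]]] :=
    filtered_rescale (t := 1) (p := a4 / 2) (q := a4 / 2 * d) (a5 / 2) _ F.
    by rewrite oner_eq0 !mulf_neq0 ?invr_eq0.
  pose g' := 2 * g / a4; pose c' := c / d.
  have [|{}f1 [{}f2 [{}f3 [{}f4 [{}f5 {}F]]]]] :=
    @shear_cube_zero _ _ mul f1 f2 f3 f4 f5 g'
      ((m - g * a5 / a4) / (a4 / 2 * d)) (g' * (c' + 1) / 2) c' two0.
    by same_table F; rewrite ?/g' ?/c'; field; rewrite ?a0 ?d0 ?two0.
  have [g0|g0] := eqVneq g' 0.
    do 8!right; left; exists c'.
    apply: (filtered_N09 dim5
      (e1 := f1) (e2 := f2) (e3 := f3) (e4 := f4) (e5 := f5)).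
    by same_table F; rewrite ?g0; ring.
  have [|{}f1 [{}f2 [{}f3 [{}f4 [{}f5 {}F]]]]] :=
    filtered_rescale (t := g') (p := g' ^+ 4) (q := - g' ^+ 5) 0 _ F.
    by rewrite g0 oppr_eq0 !expf_neq0.
  do 11!right; left; exists (- (c' + 1) / 2).
  apply: (filtered_N12 dim5
    (e1 := f1) (e2 := f2) (e3 := f3) (e4 := f4) (e5 := f5)).
  by same_table F; field; rewrite ?g0 ?two0.
move: cd F; rewrite d0 eqxx orbF mulr0 oppr0 addr0 => c0 F.
have [g0|g0] := eqVneq g 0; last first.
  (* With this [t], the choices below turn [g] into 1, [a4] and [c] into 2, and [m] into 0. *)
  pose t := 2 * g / a4.
  have t0 : t != 0 by rewrite !mulf_neq0 ?invr_eq0.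
  have [|f1 [f2 [f3 [f4 [f5 {}F]]]]] := filtered_rescale (t := t)
      (p := t ^+ 3 * g) (q := t ^+ 4 * g * c / 2) (t ^+ 3 * m) _ F.
    by rewrite t0 !mulf_neq0 ?expf_neq0 ?invr_eq0.
  do 10!right; left.
  exists (t ^+ 4 * (a5 - a4 * (t ^+ 3 * m) / (t ^+ 3 * g))
    / (t ^+ 4 * g * c / 2)).
  apply: (filtered_N11 dim5
    (e1 := f1) (e2 := f2) (e3 := f3) (e4 := f4) (e5 := f5)).
  by same_table F; rewrite ?/t; field; rewrite ?a0 ?g0 ?c0 ?two0.
move: F; rewrite g0 !mul0r => F.
have [m0|m0] := eqVneq m 0.
  have [|f1 [f2 [f3 [f4 [f5 {}F]]]]] :=
    filtered_rescale (t := 1) (p := a4 / 2) (q := a4 / 2 * c / 3) (a5 / 2) _ F.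
    by rewrite oner_eq0 !mulf_neq0 ?invr_eq0.
  do 6!right; left; exists 0.
  apply: (filtered_N07 dim5
    (e1 := f1) (e2 := f2) (e3 := f3) (e4 := f4) (e5 := f5)).
  by same_table F; rewrite ?m0; field; rewrite ?a0 ?c0 ?three0 ?two0.
(* After the rescaling the e5-coordinate of e2 e1 is m / (a4 c s^2), which has to be 1. *)
pose s := sqrtC (m / (a4 * c)).
have mE : m = a4 * c * s ^+ 2.
  by rewrite sqrtCK mulrC divfK // mulf_neq0.
have s0 : s != 0 by rewrite sqrtC_eq0 !mulf_neq0 ?invr_eq0 ?mulf_neq0.
have [|f1 [f2 [f3 [f4 [f5 {}F]]]]] := filtered_rescale (t := s)
    (p := s ^+ 4 * a4) (q := s ^+ 5 * a4 * c) (s ^+ 4 * a5) _ F.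
  by rewrite s0 !mulf_neq0 ?expf_neq0.
do 7!right; left.
apply: (filtered_N08 dim5
  (e1 := f1) (e2 := f2) (e3 := f3) (e4 := f4) (e5 := f5)).
by same_table F; rewrite ?mE; field; rewrite ?a0 ?c0 ?s0.
Qed.

(** For l = 0 the relations force b4 = 0 and h = - f. Otherwise they express all entries by [l],
    [g], [m], [b4], [b5], [d], and rescaling reaches b4 = d = l and b5 = 0. *)
Lemma listed_left e1 e2 e3 e4 e5 (l g m a4 a5 b4 b5 k4 k5 c d f h : K) :
  filtered e1 e2 e3 e4 e5 1 0 0 l g m a4 a5 b4 b5 k4 k5 c d f h ->
  (a4 != 0) || (b4 != 0) -> (c != 0) || (d != 0) -> listed mul.
Proof.
move=> F ab cd.
have [[k4E k5E fE hE] [cE aE a5E]] := novikov_relations dim5 nov F.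
move: F; rewrite {}k4E {}k5E fE => F.
have [l0|l0] := eqVneq l 0.
  have b0 : b4 = 0.
    by move/eqP: aE; rewrite l0 subr0 mul0r mulf_eq0 (negPf two0) => /eqP.
  have b5E : b5 = g * (c + d) / 2.
    by move: a5E; rewrite l0 subr0 mul0r add0r => <-; rewrite mulrC mulKf.
  move: F ab; rewrite l0 b0 b5E eqxx orbF => F a0.
  apply: (listed_zero a0 cd
    (e1 := e1) (e2 := e2) (e3 := e3) (e4 := e4) (e5 := e5)).
  same_table F => //; apply/eqP; rewrite -addr_eq0 -fE.
  by apply/eqP; move: cE; rewrite l0 b0 subr0 mul1r mul0r.
have b0 : b4 != 0.
  apply: contraTneq ab => b0; move/eqP: aE.
  by rewrite b0 mulr0 eq_sym mulf_eq0 (negPf l0) /= => ->; rewrite eqxx.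
have a4E : a4 = (2 - l) * b4 / l by rewrite aE mulrC mulKf.
have {}a5E : a5 = ((2 - l) * b5 - g * (c + d)) / l.
  by rewrite a5E addrK mulrC mulKf.
have {}hE : h = b4 * d / l by rewrite -hE mulrC mulKf.
have {}cE : c = (3 - 2 * l) * d / l.
  apply: (mulfI b0); rewrite -cE hE fE a4E; field; by rewrite l0.
have d0 : d != 0 by apply: contraTneq cd => d0; rewrite cE d0 mulr0 mul0r eqxx.
have [|f1 [f2 [f3 [f4 [f5 {}F]]]]] :=
  filtered_rescale (t := 1) (p := b4 / l) (q := b4 * d / l ^+ 2) (b5 / l) _ F.
  by rewrite oner_eq0 !mulf_neq0 ?invr_eq0 ?expf_neq0.
apply: (listed_generic l0
  (e1 := f1) (e2 := f2) (e3 := f3) (e4 := f4) (e5 := f5)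
  (g := g * l / b4) (m := (m - g * b5 / b4) * l ^+ 2 / (b4 * d))).
by same_table F; rewrite ?hE ?a5E ?a4E ?cE; field; rewrite ?b0 ?l0 ?d0.
Qed.

End Classification.

(** * Bases adapted to the descending powers *)

Section AdaptedBases.
Variables (K : fieldType) (V : vectType K) (mul : {bilinear V -> V -> V}).
Hypotheses (dim5 : \dim {:V} = 5%N) (nov : novikov mul).
Hypothesis nil : nilpotent mul.
Local Notation npow := (npow mul).
Local Notation "x ∘ y" := (mul x y) (at level 40, left associativity).

Lemma dim_span_add (s : seq V) (U : {vspace V}) :
  (\dim (<<s>> + U) <= size s + \dim U)%N.
Proof.
have [le _] := dimv_add_leqif <<s>>%VS U.
by apply: leq_trans le _; rewrite leq_add2r dim_span.
Qed.

Lemma addv_line_eq (U W : {vspace V}) v : (U <= W)%VS ->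
  (\dim W <= (\dim U).+1)%N -> v \in W -> v \notin U -> W = (<[v]> + U)%VS.
Proof.
move=> UW dimW vW vU; apply/esym/eqP; rewrite eqEdim subv_add UW -memvE vW /=.
apply: leq_trans dimW _; rewrite ltn_neqAle dimvS ?addvSr // andbT.
have [_ ->] := dimv_leqif_sup (addvSr <[v]> U).
by rewrite subv_add -memvE negb_and vU.
Qed.

Lemma dim1_line (U : {vspace V}) :
  \dim U = 1%N -> exists2 v, v != 0 & U = <[v]>%VS.
Proof.
move=> dimU; have u0 : vpick U != 0 by rewrite vpick0 -dimv_eq0 dimU.
exists (vpick U) => //; apply/esym/eqP.
by rewrite eqEdim -memvE memv_pick dim_vline u0 dimU.
Qed.

Lemma npow_zero k : \dim (npow k) = 1%N -> npow k.+1 = 0%VS.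
Proof.
move=> dimk; apply/eqP; rewrite -dimv_eq0 -leqn0 -ltnS -dimk.
by apply: dim_npow_decr => //; rewrite -dimv_eq0 dimk.
Qed.

Variable x : V.
Hypothesis xgen : generates mul x.
Local Notation y := (x ∘ x).

Lemma npow0_gen : npow 0 = (<<[:: x]>> + npow 1)%VS.
Proof. by rewrite span_seq1 xgen. Qed.

Lemma npow1_gen : npow 1 = (<<[:: y]>> + npow 2)%VS.
Proof.
rewrite {1}(npow_genS nov xgen npow0_gen); congr (_ + _)%VS.
by apply: eq_span => v; rewrite !inE orbb.
Qed.

Lemma npow2_gen : npow 2 = (<<[:: x ∘ y; y ∘ x]>> + npow 3)%VS.
Proof. exact: (npow_genS nov xgen npow1_gen). Qed.

(** The generators bound the first three drops in dimension by 1, 1 and 2, and each drop is strict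
    while the power is nonzero. *)
Lemma npow_dims :
  \dim (npow 2) = 3%N /\ (\dim (npow 3) = 1%N \/ \dim (npow 3) = 2%N).
Proof.
have le0 := dim_span_add [:: x] (npow 1); rewrite -npow0_gen dim5 /= in le0.
have le1 := dim_span_add [:: y] (npow 2); rewrite -npow1_gen /= in le1.
have le2 := dim_span_add [:: x ∘ y; y ∘ x] (npow 3).
rewrite -npow2_gen /= in le2.
have decr k : (0 < \dim (npow k))%N -> (\dim (npow k.+1) < \dim (npow k))%N.
  by move=> k0; apply: dim_npow_decr => //; rewrite -dimv_eq0 -lt0n.
have lt1 : (\dim (npow 1) < 5)%N by rewrite -dim5 decr ?dim5.
have lt2 : (\dim (npow 2) < \dim (npow 1))%N by apply: decr; lia.
have lt3 : (\dim (npow 3) < \dim (npow 2))%N by apply: decr; lia.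
by lia.
Qed.

(** Here N^3 / N^4 has dimension 2, so x y and y x serve as e3 and e4; N^4 is a line and N^5 = 0. *)
Lemma filtered_short : \dim (npow 3) = 1%N ->
  exists e5 a5 b5 k5 c d,
    [/\ npow 3 = <[e5]>%VS, npow 4 = 0%VS &
    filtered mul x y (x ∘ y) (y ∘ x) e5 1 0 0 0 1 0 0 a5 0 b5 0 k5 c d 0 0].
Proof.
move=> dim3; have n4 := npow_zero dim3.
have [e5 e50 n3] := dim1_line dim3.
have y1 : y \in npow 1 by apply: npow_mull; rewrite memvf.
have e32 : x ∘ y \in npow 2 by apply: npow_mull.
have e42 : y ∘ x \in npow 2 by apply: npow_mulr.
have in3 v : v \in npow 3 -> exists k, v = k *: e5.
  by rewrite n3 => /vlineP.
have in4 v : v \in npow 4 -> v = 0 by rewrite n4 memv0 => /eqP.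
have [a5 xe3] := in3 _ (npow_mull x e32).
have [b5 e3x] := in3 _ (npow_mulr x e32).
have [k5 yy] := in3 _ (npow_mul nov y1 y1).
have [c xe4] := in3 _ (npow_mull x e42).
have [d e4x] := in3 _ (npow_mulr x e42).
exists e5, a5, b5, k5, c, d; split=> //.
have lc5 k : k *: e5 = lc x y (x ∘ y) (y ∘ x) e5 0 0 0 0 k.
  by rewrite /lc !scale0r !add0r.
apply: filteredI => //.
- rewrite -[fullv]/(npow 0) npow0_gen npow1_gen npow2_gen n3.
  by rewrite -span_seq1 -!span_cat subvv.
- exact: lc_3.
- exact: lc_4.
- by rewrite xe3 lc5.
- by rewrite e3x lc5.
- by rewrite yy lc5.
- by rewrite xe4 lc5.
- by rewrite e4x lc5.
- by rewrite (in4 _ (npow_mul nov y1 e32)) -lc_0.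
- by rewrite (in4 _ (npow_mul nov e32 y1)) -lc_0.
- apply: in4; apply: (subvP (npow_decrS mul 4)); exact: (npow_mul nov e32 e32).
- move=> v; rewrite !inE => vE; have v1 : v \in npow 1.
    by case/or3P: vE => /eqP-> //; apply: (subvP (npow_decrS mul 1)).
  by split; apply: in4; [apply: (npow_mul nov e42) | apply: (npow_mul nov v1)].
- move=> v; have e53 : e5 \in npow 3 by rewrite n3 memv_line.
  by split; apply: in4; [apply: npow_mulr | apply: npow_mull].
Qed.

(** The nontrivial relation modulo N^5 between x e3 and e3 x makes N^4 / N^5 a line; then N^5 is a
    line and N^6 = 0. The two disjunctions express that N^4 differs from N^5 and that N^5 is
    nonzero. *)
Lemma filtered_long e3 (r s : K) :
  \dim (npow 3) = 2%N -> npow 2 = (<[e3]> + npow 3)%VS ->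
  (r != 0) || (s != 0) -> r *: (x ∘ e3) + s *: (e3 ∘ x) \in npow 4 ->
  exists e4 e5 p3 p4 p5 q3 q4 q5 a4 a5 b4 b5 k4 k5 c d f h,
    [/\ filtered mul x y e3 e4 e5 p3 p4 p5 q3 q4 q5 a4 a5 b4 b5 k4 k5 c d f h,
      (a4 != 0) || (b4 != 0), (c != 0) || (d != 0), e4 \in npow 3 &
      e5 \in npow 3].
Proof.
move=> dim3 n2 rs0 rs4.
have e32 : e3 \in npow 2 by rewrite n2 (subvP (addvSl _ _)) ?memv_line.
have n3 : npow 3 = (<<[:: x ∘ e3; e3 ∘ x]>> + npow 4)%VS.
  by apply: (npow_genS nov xgen (s := [:: e3])); rewrite span_seq1.
have [e4 {}n3g] : exists e4, npow 3 = (<[e4]> + npow 4)%VS.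
  have absorb u v (k : K) : k != 0 -> k *: u + v \in npow 4 ->
      (u \in <[v]> + npow 4)%VS.
    move=> k0 uv4; have -> : u = - k^-1 *: v + k^-1 *: (k *: u + v).
      by rewrite scalerDr addrCA scaleNr addNr addr0 scalerA mulVf ?scale1r.
    by apply: memv_add; [rewrite memvZ ?memv_line | apply: memvZ].
  have sub3 e : e \in npow 3 -> x ∘ e3 \in (<[e]> + npow 4)%VS ->
      e3 ∘ x \in (<[e]> + npow 4)%VS -> npow 3 = (<[e]> + npow 4)%VS.
    move=> e3' h1 h2; apply/eqP; rewrite eqEsubv; apply/andP; split.
      rewrite {1}n3 subv_add addvSr andbT; apply/span_subvP => v.
      by rewrite !inE => /orP[] /eqP->.
    by rewrite subv_add npow_decrS andbT -memvE.
  have line e : e \in (<[e]> + npow 4)%VS.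
    by rewrite (subvP (addvSl _ _)) ?memv_line.
  have up (k : K) v u : u \in (<[k *: v]> + npow 4)%VS ->
      u \in (<[v]> + npow 4)%VS.
    apply/subvP; rewrite addvS ?subvv // -memvE.
    by rewrite memvZ ?memv_line.
  (* A product with nonzero coefficient is a multiple of the other one modulo N^5, and the other one
     is taken as [e4]. *)
  have [r0|r0] := eqVneq r 0.
    move: rs0; rewrite r0 eqxx /= => s0; exists (x ∘ e3).
    apply: sub3 => //; first exact: npow_mull.
    by apply/(up r)/(absorb _ _ s) => //; rewrite addrC.
  exists (e3 ∘ x); apply: sub3 => //; first exact: npow_mulr.
  by apply/(up s)/(absorb _ _ r).
have dim4 : \dim (npow 4) = 1%N.
  have lt4 : (\dim (npow 4) < 2)%N.
    rewrite -[X in (_ < X)%N]dim3; apply: dim_npow_decr => //.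
    by rewrite -dimv_eq0 dim3.
  have := dim_span_add [:: e4] (npow 4).
  rewrite span_seq1 -n3g dim3 /= add1n ltnS => gt4.
  by apply/eqP; rewrite eqn_leq gt4 -ltnS lt4.
have n5 := npow_zero dim4.
have [e5 e50 n4] := dim1_line dim4.
have y1 : y \in npow 1 by apply: npow_mull; rewrite memvf.
have e43 : e4 \in npow 3 by rewrite n3g (subvP (addvSl _ _)) ?memv_line.
have e54 : e5 \in npow 4 by rewrite n4 memv_line.
pose l := lc x y e3 e4 e5.
have in5 v : v \in npow 5 -> v = 0 by rewrite n5 memv0 => /eqP.
have in4 v : v \in npow 4 -> exists k, v = l 0 0 0 0 k.
  by rewrite n4 => /vlineP[k ->]; exists k; rewrite /l /lc !scale0r !add0r.
have in3 v : v \in npow 3 -> exists a b, v = l 0 0 0 a b.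
  rewrite n3g => /memv_addP[_ /vlineP[a ->] [w /in4[b ->] ->]].
  by exists a, b; rewrite /l /lc !scale0r !add0r.
have in2 v : v \in npow 2 -> exists a b c, v = l 0 0 a b c.
  rewrite n2 => /memv_addP[_ /vlineP[a ->] [w /in3[b [c ->]] ->]].
  by exists a, b, c; rewrite /l /lc !scale0r !add0r !addrA.
have [p3 [p4 [p5 xy]]] := in2 _ (npow_mull x y1).
have [q3 [q4 [q5 yx]]] := in2 _ (npow_mulr x y1).
have [a4 [a5 xe3]] := in3 _ (npow_mull x e32).
have [b4 [b5 e3x]] := in3 _ (npow_mulr x e32).
have [k4 [k5 yy]] := in3 _ (npow_mul nov y1 y1).
have [c xe4] := in4 _ (npow_mull x e43).
have [d e4x] := in4 _ (npow_mulr x e43).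
have [f ye3] := in4 _ (npow_mul nov y1 e32).
have [h e3y] := in4 _ (npow_mul nov e32 y1).
exists e4, e5, p3, p4, p5, q3, q4, q5, a4, a5, b4, b5, k4, k5, c, d, f, h.
have n4g : npow 4 = (<<[:: x ∘ e4; e4 ∘ x]>> + npow 5)%VS.
  by apply: (npow_genS nov xgen (s := [:: e4])); rewrite span_seq1.
have l5 k : l 0 0 0 0 k = k *: e5 by rewrite /l /lc !scale0r !add0r.
split=> //; last exact: (subvP (npow_decrS mul 3)).
- apply: filteredI => //.
  + rewrite -[fullv]/(npow 0) npow0_gen npow1_gen n2 n3g n4.
    by rewrite -!span_seq1 -!span_cat subvv.
  + exact: (in5 _ (npow_mul nov e32 e32)).
  + move=> v; rewrite !inE => vE; have v1 : v \in npow 1.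
      case/or3P: vE => /eqP-> //; first exact: (subvP (npow_decrS mul 1)).
      exact: (subvP (npow_decr mul (isT : 1 <= 3)%N)).
    split; apply: in5; first exact: (npow_mul nov e43).
    exact: (npow_mul nov v1).
  + by move=> v; split; apply: in5; [apply: npow_mulr | apply: npow_mull].
- rewrite -negb_and; apply/negP => /andP[/eqP a0 /eqP b0].
  have : (npow 3 <= npow 4)%VS.
    rewrite {1}n3 subv_add subvv andbT; apply/span_subvP => v.
    rewrite !inE xe3 e3x a0 b0 !l5.
    by case/orP => /eqP ->; apply: memvZ.
  by move/dimvS; rewrite dim3 dim4.
- rewrite -negb_and; apply/negP => /andP[/eqP c0 /eqP d0].
  have : (npow 4 <= 0)%VS.
    rewrite n4g n5 addv0; apply/span_subvP => v.
    by rewrite !inE xe4 e4x c0 d0 !l5 scale0r memv0 orbb.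
  by move/dimvS; rewrite dim4 dimv0.
Qed.

End AdaptedBases.

(** * Case distinction by the dimension of N^4 and by whether x y lies in N^4 *)

Theorem one_generated_novikov5_listed (K : numClosedFieldType) (V : vectType K)
    (mul : {bilinear V -> V -> V}) :
  \dim {:V} = 5%N -> novikov mul -> nilpotent mul -> one_generated mul ->
  listed mul.
Proof.
move=> dim5 nov nil /one_generated_generates[x xgen].
have [rc ls] := nov; set y := mul x x in rc ls *.
have [dim2 [dim3|dim3]] := npow_dims dim5 nov nil xgen.
  have [e5 [a5 [b5 [k5 [c [d [n3 n4 F]]]]]]] :=
    filtered_short nov nil xgen dim3.
  (* If [a5], [b5] and [d] vanished, so would [c], and the products spanning N^4 would all be zero,
     although N^4 has dimension 1. *)
  apply: (listed_short dim5 nov F); apply: contraT.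
  rewrite !negb_or !negbK => /and3P[/eqP a0 /eqP b0 /eqP d0].
  have [_ c0] := novikov_relations_short dim5 nov F.
  move: F; rewrite a0 b0 d0 c0 b0 d0 mulr0 subr0 => -[_ mulE].
  have : (npow mul 3 <= 0)%VS.
    rewrite (npow_genS nov xgen (npow2_gen nov xgen)) n4 addv0.
    apply/span_subvP => v; rewrite !inE /= memv0.
    set e3 := mul x y; set e4 := mul y x.
    have := (mulE 1 0 0 0 0 0 0 1 0 0, mulE 1 0 0 0 0 0 0 0 1 0,
             mulE 0 0 1 0 0 1 0 0 0 0, mulE 0 0 0 1 0 1 0 0 0 0).
    rewrite -lc_1 -lc_3 -lc_4 !(mul0r, mulr0, addr0, add0r) -lc_0.
    by move=> [[[-> ->] ->] ->]; rewrite !orbb.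
  by move/dimvS; rewrite dim3 dimv0.
have y1 : y \in npow mul 1 by apply: npow_mull; rewrite memvf.
have yy : mul y y = mul (mul x y) x by exact: rc.
(* This supplies the relation required by [filtered_long] in both remaining cases. *)
have lsx : mul (mul x y) x - mul x (mul y x) =
    mul (mul y x) x - mul (mul x y) x by rewrite (ls x y x) -/y yy.
have [e33|e33] := boolP (mul x y \in npow mul 3).
  have z3 : mul y x \notin npow mul 3.
    apply/negP => z3; have : (npow mul 2 <= npow mul 3)%VS.
      rewrite (npow2_gen nov xgen) subv_add subvv andbT.
      by apply/span_subvP => v; rewrite !inE => /orP[] /eqP->.
    by move/dimvS; rewrite dim2 dim3.
  have n2 : npow mul 2 = (<[mul y x]> + npow mul 3)%VS.
    apply: addv_line_eq; rewrite ?npow_decrS ?dim2 ?dim3 //.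
    exact: npow_mulr.
  (* As x y lies in N^4, the product (x y) x lies in N^5. *)
  have rel : 1 *: mul x (mul y x) + 1 *: mul (mul y x) x \in npow mul 4.
    rewrite !scale1r; suff -> : mul x (mul y x) + mul (mul y x) x =
        mul (mul x y) x *+ 2 by apply/rpredMn/npow_mulr.
    rewrite mulr2n -{1}[mul (mul x y) x](subrK (mul x (mul y x))) lsx.
    by rewrite addrAC subrK addrC.
  have [|e4 [e5 [p3 [p4 [p5 [q3 [q4 [q5
    [a4 [a5 [b4 [b5 [k4 [k5 [c [d [f [h]]]]]]]]]]]]]]]]]] :=
    filtered_long nov nil xgen dim3 n2 _ rel.
    by rewrite oner_eq0.
  move=> [F ab cd e43 e53].
  have [spanE mulE] := F.
  have := mulE 0 1 0 0 0 1 0 0 0 0; rewrite -lc_1 -lc_2.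
  rewrite !(mul0r, mulr0, mulr1, addr0, add0r) {1}(lc_3 x y (mul y x) e4 e5).
  move/(lc_inj spanE dim5) => [_ _ q3E q4E q5E].
  have := mulE 1 0 0 0 0 0 1 0 0 0; rewrite -lc_1 -lc_2.
  rewrite !(mul0r, mulr0, mulr1, addr0, add0r) => xyE.
  (* Otherwise y x would be a combination of x y, [e4] and [e5], all of which lie in N^4. *)
  have p3E : p3 = 0.
    apply/eqP; apply: contraNT z3 => p30.
    have -> : mul y x = p3^-1 *: (mul x y - (p4 *: e4 + p5 *: e5)).
      rewrite xyE /lc !scale0r !add0r.
      by rewrite -[_ + _ + p5 *: e5]addrA addrK scalerA mulVf // scale1r.
    by apply/memvZ/memvB => //; apply: memvD; apply: memvZ.
  move: F; rewrite p3E -q3E -q4E -q5E => F.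
  exact: (listed_right dim5 nov F ab cd).
have n2 : npow mul 2 = (<[mul x y]> + npow mul 3)%VS.
  by apply: addv_line_eq; rewrite ?npow_decrS ?dim2 ?dim3 //; apply: npow_mull.
have [l [w w3 yx]] : exists l,
    exists2 w, w \in npow mul 3 & mul y x = l *: mul x y + w.
  have : mul y x \in npow mul 2 by apply: npow_mulr.
  by rewrite n2 => /memv_addP[_ /vlineP[l ->] [w w3 ->]]; exists l, w.
(* Obtained by substituting y x = l x y + w into [lsx]; the coefficients - l and 2 - l never vanish
   together. *)
have rel : - l *: mul x (mul x y) + (2 - l) *: mul (mul x y) x \in npow mul 4.
  have -> : - l *: mul x (mul x y) + (2 - l) *: mul (mul x y) x =
      mul x w + mul w x.
    2: by apply: memvD; [apply: npow_mull | apply: npow_mulr].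
  move: lsx; rewrite yx linearDr linearDl linearZr_LR linearZl_LR /=.
  move: (mul _ w) (mul w _) => p q.
  move: (mul x (mul x y)) (mul (mul x y) x) => b a H.
  have {}H : a - l *: b = l *: a + q - a + p by rewrite -H opprD addrA subrK.
  rewrite scalerBl scaler_nat mulr2n scaleNr addrCA -addrACA H.
  rewrite addrA [_ + p + a]addrAC subrK -[_ + q + p]addrA addrAC.
  by rewrite subrr add0r addrC.
have [|e4 [e5 [p3 [p4 [p5 [q3 [q4 [q5
    [a4 [a5 [b4 [b5 [k4 [k5 [c [d [f [h]]]]]]]]]]]]]]]]]] :=
  filtered_long nov nil xgen dim3 n2 _ rel.
  rewrite oppr_eq0; have [->|//] := eqVneq l 0.
  by rewrite subr0 pnatr_eq0.
move=> [F ab cd _ _]; have [spanE mulE] := F.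
have := mulE 1 0 0 0 0 0 1 0 0 0; rewrite -lc_1 -lc_2.
rewrite !(mul0r, mulr0, mulr1, addr0, add0r) {1}(lc_3 x y (mul x y) e4 e5).
move/(lc_inj spanE dim5) => [_ _ p3E p4E p5E].
move: F; rewrite -p3E -p4E -p5E => F.
exact: (listed_left dim5 nov F ab cd).
Qed.

Theorem theorem6 (R : realType) (V : vectType R[i])
    (mul : {bilinear V -> V -> V}) (hdim : \dim {:V} = 5%N)
    (hnov : novikov mul) (hnil : nilpotent mul) (hgen : one_generated mul) :
  alg_isomorphic mul (@N01 _)
  \/ (exists l : R[i], alg_isomorphic mul (N02 l))
  \/ (exists l m : R[i], alg_isomorphic mul (N03 l m))
  \/ (exists l : R[i], l != 0 /\ alg_isomorphic mul (N04 l))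
  \/ alg_isomorphic mul (@N05 _)
  \/ alg_isomorphic mul (@N06 _)
  \/ (exists l : R[i], alg_isomorphic mul (N07 l))
  \/ alg_isomorphic mul (@N08 _)
  \/ (exists l : R[i], alg_isomorphic mul (N09 l))
  \/ alg_isomorphic mul (@N10 _)
  \/ (exists l : R[i], alg_isomorphic mul (N11 l))
  \/ (exists l : R[i], alg_isomorphic mul (N12 l))
  \/ (exists l : R[i], alg_isomorphic mul (N13 l)).
Proof. exact: one_generated_novikov5_listed. Qed.
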